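(* Let $A$ be a $C^*$-algebra. Then the following are equivalent: (i) $A$ is $\ell$-open. (ii) The system of maps $\mathrm{Hom}(A,B)\to\mathrm{Hom}(A,B/J)$ (over all $C^*$-algebras $B$ and ideals $J$ of $B$) is uniformly open, that is: for any $\epsilon>0$ and any finite set $\mathcal F\subset A$, there are a $\delta>0$ and a finite set $\mathcal G\subset A$ such that whenever $B$ is a $C^*$-algebra, $J$ is an ideal of $B$, $\gamma,\varphi:A\to B/J$ are $^*$-homomorphisms with $\|\gamma(u)-\varphi(u)\|<\delta$ for all $u\in\mathcal G$, and $\overline\gamma:A\to B$ is a $^*$-homomorphism lifting $\gamma$, then $\varphi$ lifts to a $^*$-homomorphism $\overline\varphi:A\to B$ with $\|\overline\gamma(v)-\overline\varphi(v)\|<\epsilon$ for all $v\in\mathcal F$. (iii) $A$ satisfies the conclusion of the Homotopy Lifting Theorem, and $\mathrm{Hom}(A,B)$ is locally path-connected for all $C^*$-algebras $B$.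
   Context: Ideals of $C^*$-algebras are closed and two-sided; for an ideal $I$ of a $C^*$-algebra $B$, $\pi_I:B\to B/I$ is the quotient map. $\mathrm{Hom}(A,B)$ is the space of all $^*$-homomorphisms $A\to B$ (not necessarily unital) with the point-norm topology: a neighbourhood base at $\phi$ is given by the sets $\{\psi: \|\psi(a)-\phi(a)\|<\epsilon\ \forall a\in\mathcal F\}$, over finite $\mathcal F\subset A$ and $\epsilon>0$. A $^*$-homomorphism $\overline\phi:A\to B$ is a lift of $\phi:A\to B/I$ if $\phi=\pi_I\circ\overline\phi$; $\phi$ is liftable if it has a lift. $A$ is $\ell$-open if for every $C^*$-algebra $B$ and ideal $I$ of $B$, the set of liftable $^*$-homomorphisms $\{\pi_I\circ\phi:\phi\in\mathrm{Hom}(A,B)\}$ is open in $\mathrm{Hom}(A,B/I)$. $A$ satisfies the conclusion of the Homotopy Lifting Theorem if: for every $C^*$-algebra $B$, every ideal $I$ of $B$, every point-norm continuous path $(\varphi_t)_{t\in[0,1]}$ of $^*$-homomorphisms $A\to B/I$, and every $^*$-homomorphism $\overline{\varphi_0}:A\to B$ lifting $\varphi_0$, there is a point-norm continuous path $(\overline{\varphi_t})_{t\in[0,1]}$ of $^*$-homomorphisms $A\to B$ starting at the given $\overline{\varphi_0}$ such that $\overline{\varphi_t}$ is a lift of $\varphi_t$ for all $t\in[0,1]$. *)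

(* Defs.v *)
From HB Require Import structures.
From mathcomp Require Import all_boot all_order all_algebra ring_quotient.
From mathcomp Require Import generic_quotient finmap complex lra ring.
From mathcomp Require Import all_classical all_reals all_analysis.

Set Implicit Arguments.
Unset Strict Implicit.
Unset Printing Implicit Defensive.

Import Order.TTheory GRing.Theory Num.Theory.
Import numFieldNormedType.Exports.

Local Open Scope classical_set_scope.
Local Open Scope complex_scope.
Local Open Scope ring_scope.

(* Neither a unit nor non-triviality is required. *)
HB.mixin Record NormedModule_isCStarAlgebra (R : realType) A
    & CompleteNormedModule R[i] A := {
  cmul : A -> A -> A;
  cstar : A -> A;
  cmulA : associative cmul;
  cmulDl : left_distributive cmul +%R;
  cmulDr : right_distributive cmul +%R;
  cmulZl : forall (k : R[i]) x y, cmul (k *: x) y = k *: cmul x y;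
  cmulZr : forall (k : R[i]) x y, cmul x (k *: y) = k *: cmul x y;
  cstarD : {morph cstar : x y / x + y};
  cstarZ : forall (k : R[i]) x, cstar (k *: x) = k^* *: cstar x;
  cstarM : forall x y, cstar (cmul x y) = cmul (cstar y) (cstar x);
  cstarK : involutive cstar;
  ler_normcM : forall x y, `|cmul x y| <= `|x| * `|y|;
  normcstarM : forall x, `|cmul (cstar x) x| = `|x| ^+ 2;
}.

#[short(type="cstarAlgType")]
HB.structure Definition CStarAlgebra (R : realType) :=
  {A of NormedModule_isCStarAlgebra R A & CompleteNormedModule R[i] A}.

Declare Scope cstar_scope.
Delimit Scope cstar_scope with cstar.
Local Open Scope cstar_scope.
Notation "x ∙ y" := (cmul x y) (at level 40, left associativity) : cstar_scope.
Notation "x ^†" := (cstar x) (at level 2, format "x ^†") : cstar_scope.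

Record ideal (R : realType) (B : cstarAlgType R) := Ideal {
  ideal_set : set B;
  ideal0 : ideal_set 0;
  idealD : forall x y, ideal_set x -> ideal_set y -> ideal_set (x + y);
  idealZ : forall (k : R[i]) x, ideal_set x -> ideal_set (k *: x);
  idealMl : forall x y, ideal_set y -> ideal_set (x ∙ y);
  idealMr : forall x y, ideal_set x -> ideal_set (x ∙ y);
  ideal_closed : closed ideal_set
}.

Section RealNorm.
Variable R : realType.

(* The norm of a normed module over R[i] is R[i]-valued; nrm is that value in R. *)
Definition nrm (V : normedModType R[i]) (x : V) : R := complex.Re `|x|.

Section NormedModule.
Variable V : normedModType R[i].
Implicit Types x y : V.

Lemma nrmE x : `|x| = (nrm x)%:C.
Proof. by rewrite /nrm RRe_real// ger0_real. Qed.

Lemma nrm_ge0 x : 0 <= nrm x.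
Proof. by rewrite -lecR -nrmE normr_ge0. Qed.

Lemma nrm0 : nrm (0 : V) = 0.
Proof. by rewrite /nrm normr0. Qed.

Lemma nrm_eq0 x : nrm x = 0 -> x = 0.
Proof. by move=> x0; apply/normr0_eq0; rewrite nrmE x0. Qed.

Lemma nrmN x : nrm (- x) = nrm x.
Proof. by rewrite /nrm normrN. Qed.

Lemma nrmBC x y : nrm (x - y) = nrm (y - x).
Proof. by rewrite -nrmN opprB. Qed.

Lemma nrmD x y : nrm (x + y) <= nrm x + nrm y.
Proof. by rewrite -lecR rmorphD/= -!nrmE ler_normD. Qed.

Lemma nrmB x y : nrm (x - y) <= nrm x + nrm y.
Proof. by rewrite -(nrmN y) nrmD. Qed.

Lemma nrm_triangle y x z : nrm (x - z) <= nrm (x - y) + nrm (y - z).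
Proof. by rewrite -[x - z](subrKA y) nrmD. Qed.

Lemma nrmZ (k : R[i]) x : nrm (k *: x) = complex.Re `|k| * nrm x.
Proof.
rewrite {1}/nrm normrZ nrmE -[in LHS](RRe_real (normr_real k)) -rmorphM.
by [].
Qed.

Lemma nrmZR (k : R) x : nrm (k%:C *: x) = `|k| * nrm x.
Proof. by rewrite nrmZ normc_def/= expr0n/= addr0 sqrtr_sqr. Qed.

Lemma cplx_gt0 (e : R[i]) : 0 < e -> exists2 r : R, 0 < r & e = r%:C.
Proof.
move=> e0; have eE : (complex.Re e)%:C = e by rewrite RRe_real// gtr0_real.
by exists (complex.Re e) => //; rewrite -ltcR eE.
Qed.

Definition nrm_closed (S : set V) :=
  forall x, (forall e : R, 0 < e -> exists2 y, S y & nrm (x - y) < e) -> S x.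

Lemma closed_nrm (S : set V) : closed S -> nrm_closed S.
Proof.
move=> cS x xS; apply: cS => U /nbhs_ballP[e /cplx_gt0[r r0 ->] eU].
have [y Sy xy] := xS _ r0; exists y; split=> //; apply: eU.
by rewrite -ball_normE/= nrmE ltcR.
Qed.

Lemma nrm_closedI (S T : set V) :
  nrm_closed S -> nrm_closed T -> nrm_closed (S `&` T).
Proof.
by move=> cS cT x xST; split; [apply: cS|apply: cT] => e /xST[y [Sy Ty] xy];
  exists y.
Qed.

Lemma nrm_closed_le (r : R) : nrm_closed [set x | nrm x <= r].
Proof.
move=> x xr /=; apply/ler_addgt0Pr => e /xr[y /= yr xy].
rewrite -[x](subrK y) addrC; apply: le_trans (nrmD _ _) _.
exact: lerD yr (ltW xy).
Qed.

Lemma nrm_small x (K : R) : (forall e : R, 0 < e -> nrm x <= K * e) -> x = 0.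
Proof.
move=> xK; apply: nrm_eq0; apply/eqP; rewrite eq_le nrm_ge0 andbT.
apply/ler_addgt0Pr => e e0; rewrite add0r.
have K0 : 0 < `|K| + 1 by rewrite ltr_wpDl.
apply: (le_trans (xK (e / (`|K| + 1)) _)); first by rewrite divr_gt0.
rewrite mulrCA ger_pMr// ler_pdivrMr// mul1r (le_trans (ler_norm _))//.
by rewrite lerDl.
Qed.

Lemma nrm_closed_ker (f : V -> V) (K : R) : (forall x y, f (x - y) = f x - f y) ->
  (forall x, nrm (f x) <= K * nrm x) -> nrm_closed [set x | f x = 0].
Proof.
move=> fB fK x xS /=; apply: (@nrm_small _ `|K|) => e /xS[y /= fy0 xy].
rewrite -[f x]subr0 -fy0 -fB (le_trans (fK _))//.
apply: (@le_trans _ _ (`|K| * nrm (x - y))).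
  by rewrite ler_wpM2r ?nrm_ge0 ?ler_norm.
by rewrite ler_wpM2l// ltW.
Qed.

End NormedModule.

Lemma expr_small (q c e : R) : 0 <= q < 1 -> 0 < e -> exists n, c * q ^+ n < e.
Proof.
move=> /andP[q0 q1] e0.
have /cvgrPdist_lt/(_ e e0)[N _ /(_ N (leqnn _))] :
    geometric c q n @[n --> \oo] --> 0 by apply: cvg_geometric; rewrite ger0_norm.
by rewrite sub0r normrN/= => /(le_lt_trans (ler_norm _)) ?; exists N.
Qed.

Section Complete.
Variable V : completeNormedModType R[i].

Lemma fast_cauchy (u : nat -> V) (c q : R) : 0 <= c -> 0 <= q < 1 ->
  (forall n, nrm (u n.+1 - u n) <= c * q ^+ n) ->
  exists l, forall n, nrm (l - u n) <= c * q ^+ n / (1 - q).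
Proof.
move=> c0 /[dup] qlt /andP[q0 q1] uc.
have q'0 : 0 < 1 - q by rewrite subr_gt0.
have du n m : nrm (u (m + n)%N - u n) <= c * q ^+ n / (1 - q).
  have : nrm (u (m + n)%N - u n) <= c * q ^+ n * (1 - q ^+ m) / (1 - q).
    elim: m => [|m IH]; first by rewrite expr0 !subrr nrm0 mulr0 mul0r.
    apply: le_trans (nrm_triangle (u (m + n)%N) _ _) _.
    apply: le_trans (lerD (uc _) IH) _.
    rewrite ler_pdivlMr// mulrDl divfK ?gt_eqF// exprD exprS.
    by rewrite le_eqVlt; apply/orP; left; apply/eqP; ring.
  move/le_trans; apply; rewrite ler_wpM2r ?invr_ge0 ?(ltW q'0)//.
  by rewrite ler_piMr ?mulr_ge0 ?exprn_ge0// lerBlDr lerDl exprn_ge0.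
have small n m e : (n <= m)%N -> c * q ^+ n / (1 - q) < e -> nrm (u m - u n) < e.
  by move=> nm; apply: le_lt_trans; rewrite -(subnK nm).
have : cvgn u.
  apply/cauchy_cvgP/cauchy_exP => _ /cplx_gt0[e e0 ->].
  have [n] := expr_small (c / (1 - q)) qlt e0.
  rewrite mulrAC => nq; exists (u n), n => // m /= nm.
  by rewrite -ball_normE/= nrmE ltcR nrmBC; exact: (small n).
move=> /cvg_ex[l ul]; exists l => n; apply/ler_addgt0Pr => e e0.
have /cvgrPdist_lt/(_ e%:C) := ul; rewrite ltcR => /(_ e0)[N _ uN].
have := uN (maxn N n) (leq_maxl _ _); rewrite nrmE ltcR => /= lu.
apply: le_trans (nrm_triangle (u (maxn N n)) _ _) _.
by rewrite addrC lerD ?(ltW lu)// -(subnK (leq_maxr N n)).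
Qed.

Lemma nrm_fixpoint (S : set V) (f : V -> V) (q : R) : nrm_closed S ->
  0 <= q < 1 -> S 0 -> (forall x, S x -> S (f x)) ->
  (forall x y, S x -> S y -> nrm (f x - f y) <= q * nrm (x - y)) ->
  exists2 x, S x & f x = x.
Proof.
move=> cS qlt S0 fS fq; have /andP[q0 q1] := qlt.
pose u n := iter n f 0; have Su n : S (u n) by elim: n => //= n; exact: fS.
have uc n : nrm (u n.+1 - u n) <= nrm (f 0) * q ^+ n.
  elim: n => [|n IH]; first by rewrite expr0 mulr1 /= subr0.
  apply: (le_trans (fq (u n.+1) (u n) (Su _) (Su _))).
  by rewrite exprS mulrCA ler_wpM2l.
have [l lu] := fast_cauchy (nrm_ge0 _) qlt uc.
pose c := nrm (f 0) / (1 - q).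
have {}lu n : nrm (l - u n) <= c * q ^+ n by rewrite mulrAC.
have Sl : S l.
  apply: cS => e e0; have [n cn] := expr_small c qlt e0.
  by exists (u n) => //; apply: le_lt_trans cn.
exists l => //; apply/eqP; rewrite -subr_eq0; apply/eqP.
apply: (@nrm_small _ _ 2) => e e0; have [n cn] := expr_small c qlt e0.
apply: le_trans (nrm_triangle (u n.+1) _ _) _.
rewrite mulr_natl mulr2n lerD//.
  apply: (le_trans (fq l (u n) Sl (Su n))).
  apply: le_trans (ltW cn); apply: le_trans (lu n).
  by rewrite ler_piMl ?nrm_ge0 ?ltW.
rewrite nrmBC; apply: le_trans (lu _) _; apply: le_trans (ltW cn).
have c0 : 0 <= c by rewrite divr_ge0 ?nrm_ge0// subr_ge0 ltW.
by rewrite ler_wpM2l// exprS ler_piMl ?exprn_ge0// ltW.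
Qed.

End Complete.
End RealNorm.

(* Approximate units of closed two-sided ideals, obtained without functional
   calculus. They are what makes B / I a C*-algebra: closed two-sided ideals
   are stable under the involution, and the quotient norm satisfies the
   C*-identity. *)
Section ApproximateUnit.
Variables (R : realType) (B : cstarAlgType R).
Implicit Types (x y a h r e : B) (I : ideal B).

Lemma cmulNl x y : (- x) ∙ y = - (x ∙ y).
Proof. by rewrite -scaleN1r cmulZl scaleN1r. Qed.

Lemma cmulNr x y : x ∙ (- y) = - (x ∙ y).
Proof. by rewrite -scaleN1r cmulZr scaleN1r. Qed.

Lemma cmulBl x y z : (x - y) ∙ z = x ∙ z - y ∙ z.
Proof. by rewrite cmulDl cmulNl. Qed.

Lemma cmulBr x y z : x ∙ (y - z) = x ∙ y - x ∙ z.
Proof. by rewrite cmulDr cmulNr. Qed.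

Lemma cmul0l x : 0 ∙ x = 0.
Proof. by apply: (addIr (0 ∙ x)); rewrite -cmulDl !add0r. Qed.

Lemma cmul0r x : x ∙ 0 = 0.
Proof. by apply: (addIr (x ∙ 0)); rewrite -cmulDr !add0r. Qed.

Lemma cstarN x : (- x)^† = - x^†.
Proof. by rewrite -scaleN1r cstarZ rmorphN1 scaleN1r. Qed.

Lemma cstarB x y : (x - y)^† = x^† - y^†.
Proof. by rewrite cstarD cstarN. Qed.

Lemma cstar0 : 0^† = 0 :> B.
Proof. by apply: (addIr 0^†); rewrite -cstarD !add0r. Qed.

Lemma cstarZR (k : R) x : (k%:C *: x)^† = k%:C *: x^†.
Proof. by rewrite cstarZ conj_Creal// complex_real. Qed.

Lemma nrmM x y : nrm (x ∙ y) <= nrm x * nrm y.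
Proof. by rewrite -lecR rmorphM/= -!nrmE ler_normcM. Qed.

Lemma nrm_cstarM x : nrm (x^† ∙ x) = nrm x ^+ 2.
Proof. by apply/complexI; rewrite rmorphXn/= -!nrmE normcstarM. Qed.

Lemma nrm_cstar x : nrm x^† = nrm x.
Proof.
suff le y : nrm y <= nrm y^†.
  by apply/eqP; rewrite eq_le le andbT -{2}(cstarK x) le.
have [y0|y0] := leP (nrm y) 0; first by rewrite (le_trans y0) ?nrm_ge0.
by rewrite -(ler_pM2r y0) -expr2 -nrm_cstarM nrmM.
Qed.

Lemma nrm_Mcstar x : nrm (x ∙ x^†) = nrm x ^+ 2.
Proof. by rewrite -{1}(cstarK x) nrm_cstarM nrm_cstar. Qed.

Lemma idealN I x : ideal_set I x -> ideal_set I (- x).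
Proof. by rewrite -scaleN1r; exact: idealZ. Qed.

Lemma idealB I x y : ideal_set I x -> ideal_set I y -> ideal_set I (x - y).
Proof. by move=> Ix Iy; apply: idealD => //; exact: idealN. Qed.

Lemma nrm_closed_self : nrm_closed [set x : B | x^† - x = 0].
Proof.
apply: (@nrm_closed_ker _ _ _ 2) => [x y|x].
  by rewrite cstarB !opprB addrACA [RHS]addrACA [- y^† - x]addrC.
by rewrite (le_trans (nrmB _ _))// nrm_cstar mulr_natl.
Qed.

Lemma nrm_closed_comm a : nrm_closed [set x | x ∙ a - a ∙ x = 0].
Proof.
apply: (@nrm_closed_ker _ _ _ (2 * nrm a)) => [x y|x].
  by rewrite cmulBr cmulBl !opprB addrACA [RHS]addrACA [- (y ∙ a) - _]addrC.
rewrite (le_trans (nrmB _ _))// -mulrA mulr_natl mulr2n lerD// ?nrmM//.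
by rewrite mulrC nrmM.
Qed.

(* r = 1 - sqrt (1 - a^2) in the unitization of B. *)
Lemma ex_sqrt a : a^† = a -> nrm a < 1 ->
  exists r, [/\ r^† = r, r ∙ a = a ∙ r & r + r = a ∙ a + r ∙ r].
Proof.
move=> aa a1.
pose f r := (2^-1)%:C *: (a ∙ a + r ∙ r).
pose S := [set x | nrm x <= nrm a] `&` ([set x | x^† - x = 0]
  `&` [set x | x ∙ a - a ∙ x = 0]).
have n2 : `|2^-1 : R| = 2^-1 by rewrite ger0_norm.
have ln (x y : R) : x <= y + y -> 2^-1 * x <= y.
  by move=> xy; rewrite ler_pdivrMl// mulr_natl.
have cS : nrm_closed S.
  apply: nrm_closedI; first exact: nrm_closed_le.
  by apply: nrm_closedI; [exact: nrm_closed_self|exact: nrm_closed_comm].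
have S0 : S 0.
  by split; rewrite /= ?nrm0 ?nrm_ge0//; split;
    rewrite /= ?cstar0 ?cmul0l ?cmul0r subrr.
have fS x : S x -> S (f x).
  move=> [/= xle [/subr0_eq xs /subr0_eq xa]]; split; [|split] => /=.
  - rewrite /f nrmZR n2 ln// (le_trans (nrmD _ _))// lerD//.
      by rewrite (le_trans (nrmM _ _))// ler_piMl ?nrm_ge0// ltW.
    rewrite (le_trans (nrmM _ _))// (le_trans _ xle)// ler_piMl ?nrm_ge0//.
    by rewrite (le_trans xle)// ltW.
  - by apply/eqP; rewrite subr_eq0 /f cstarZR cstarD !cstarM aa xs.
  - apply/eqP; rewrite subr_eq0 /f cmulZl cmulZr cmulDl cmulDr; apply/eqP.
    by congr (_ *: (_ + _)); rewrite ?cmulA// -cmulA xa cmulA xa.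
have fq x y : S x -> S y -> nrm (f x - f y) <= nrm a * nrm (x - y).
  move=> [/= xle _] [/= yle _].
  rewrite /f -scalerBr nrmZR n2 ln//.
  have -> : a ∙ a + x ∙ x - (a ∙ a + y ∙ y) = x ∙ (x - y) + (x - y) ∙ y.
    by rewrite opprD addrACA subrr add0r cmulBr cmulBl addrA subrK.
  rewrite (le_trans (nrmD _ _))// lerD// (le_trans (nrmM _ _))//.
    by rewrite ler_wpM2r ?nrm_ge0.
  by rewrite mulrC ler_wpM2r ?nrm_ge0.
have q01 : 0 <= nrm a < 1 by rewrite nrm_ge0.
have [r [_ [/= /subr0_eq rs /subr0_eq ra]] fr] := nrm_fixpoint cS q01 S0 fS fq.
exists r; split=> //.
rewrite -{1 2}fr /f -scalerDl -rmorphD/=.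
by rewrite (_ : 2^-1 + 2^-1 = 1) ?scale1r//; lra.
Qed.

Lemma nrm_cross (k : R[i]) x y : k^* = - k -> k * k = -1 ->
  x^† ∙ y = y^† ∙ x -> nrm (x + k *: y) ^+ 2 = nrm (x^† ∙ x + y^† ∙ y).
Proof.
move=> kc kk xy; rewrite -nrm_cstarM cstarD cstarZ kc scaleNr.
rewrite cmulBl !cmulDr !cmulZr !cmulZl scalerA kk scaleN1r xy opprB.
by rewrite addrACA subrr addr0.
Qed.

Lemma nrm_sub_sqrt a r y : a^† = a -> r^† = r -> r ∙ a = a ∙ r ->
  r + r = a ∙ a + r ∙ r -> nrm (y - r ∙ y) <= nrm y.
Proof.
move=> aa rr ra ar; set w := y - r ∙ y; set p := a ∙ y.
have pw : p^† ∙ w = w^† ∙ p.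
  rewrite /p /w cstarM cstarB cstarM aa rr -cmulA cmulBl -!cmulA -cmulBr.
  by congr (_ ∙ _); rewrite cmulBr !cmulA ra.
have pwy : p^† ∙ p + w^† ∙ w = y^† ∙ y.
  rewrite /p {1}/w cstarM cstarB cstarM aa rr cmulBl -!cmulA -cmulBr -cmulDr.
  congr (_ ∙ _); rewrite cmulBr !cmulA.
  have -> : a ∙ a = r + r - r ∙ r by rewrite ar addrK.
  rewrite cmulBl cmulDl opprB [y - _ + _]addrACA -opprD [LHS]addrC subrKA.
  by rewrite addrK.
have cross (k : R[i]) : k^* = - k -> k * k = -1 -> nrm (p + k *: w) = nrm y.
  move=> kc kk; apply/eqP; rewrite -(@eqrXn2 _ 2) ?nrm_ge0//.
  by rewrite nrm_cross// pwy nrm_cstarM.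
have ii : 'i * 'i = -1 :> R[i] by rewrite -expr2 sqrCi.
have k1 := cross 'i (conjCi _) ii.
have k2 : nrm (p + (- 'i) *: w) = nrm y.
  by apply: cross; rewrite ?rmorphN/= ?conjCi// mulrNN.
have : nrm ((p + 'i *: w) - (p + (- 'i) *: w)) <= nrm y + nrm y.
  by rewrite (le_trans (nrmB _ _))// k1 k2.
rewrite opprD addrACA subrr add0r scaleNr opprK -mulr2n -scaler_nat scalerA.
rewrite nrmZ normrM normCi mulr1 normr_nat -mulr2n -[leRHS]mulr_natl.
by rewrite -(rmorph_nat (real_complex R))/= ler_pM2l.
Qed.

Lemma nrm_sub_square a y : a^† = a -> nrm a < 1 ->
  nrm (y - a ∙ a ∙ y) <= nrm y.
Proof.
move=> aa a1; have [r [rr ra ar]] := ex_sqrt aa a1.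
have le z : nrm (z - r ∙ z) <= nrm z by exact: (nrm_sub_sqrt z aa rr ra ar).
suff -> : y - a ∙ a ∙ y = (y - r ∙ y) - r ∙ (y - r ∙ y).
  exact: le_trans (le _) (le _).
have -> : a ∙ a = r + r - r ∙ r by rewrite ar addrK.
rewrite cmulBl cmulDl cmulBr cmulA !opprB opprD.
by rewrite [RHS]addrACA -addrA.
Qed.

(* e = h (1/q - 1 + h)^-1; as q tends to 1, h - e h tends to 0. *)
Lemma ex_resolvent I h (q : R) : ideal_set I h -> h^† = h ->
    (forall y, nrm (y - h ∙ y) <= nrm y) -> 0 <= q < 1 ->
  exists e, [/\ ideal_set I e, e^† = e, e ∙ h = h ∙ e &
    e = q%:C *: (h + (e - h ∙ e))].
Proof.
move=> Ih hh hle q01; have /andP[q0 q1] := q01.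
pose f e := q%:C *: (h + (e - h ∙ e)).
pose S := ideal_set I `&` ([set x | x^† - x = 0]
  `&` [set x | x ∙ h - h ∙ x = 0]).
have cS : nrm_closed S.
  apply: nrm_closedI; first exact: (closed_nrm (@ideal_closed _ _ I)).
  by apply: nrm_closedI; [exact: nrm_closed_self|exact: nrm_closed_comm].
have S0 : S 0.
  split; first exact: ideal0.
  by split; rewrite /= ?cstar0 ?cmul0l ?cmul0r subrr.
have fS x : S x -> S (f x).
  move=> [Ix [/= /subr0_eq xs /subr0_eq xh]]; split; [|split] => /=.
  - by apply: idealZ; apply: idealD => //; apply: idealB => //; exact: idealMl.
  - apply/eqP; rewrite subr_eq0 /f cstarZR cstarD cstarB cstarM hh xs.
    by rewrite xh.
  - apply/eqP; rewrite subr_eq0 /f cmulZl cmulZr; apply/eqP; congr (_ *: _).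
    by rewrite cmulDl cmulDr cmulBl cmulBr xh -cmulA xh.
have fq x y : S x -> S y -> nrm (f x - f y) <= q * nrm (x - y).
  move=> _ _; rewrite /f -scalerBr nrmZR ger0_norm// ler_wpM2l//.
  rewrite opprD addrACA subrr add0r opprD addrACA -opprD -cmulBr.
  exact: hle.
have [e [Ie [/= /subr0_eq es /subr0_eq eh]] fe] := nrm_fixpoint cS q01 S0 fS fq.
by exists e.
Qed.

Lemma nrm_sub_resolvent h e (q : R) y :
    (forall y, nrm (y - h ∙ y) <= nrm y) -> 0 <= q < 1 ->
    e = q%:C *: (h + (e - h ∙ e)) ->
  nrm (y - e ∙ y) <= nrm y.
Proof.
move=> hle /andP[q0 q1] eE; set g := y - e ∙ y.
have gE : g = (1 - q)%:C *: y + q%:C *: (g - h ∙ g).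
  have eyE : e ∙ y = q%:C *: (y - (g - h ∙ g)).
    rewrite [in LHS]eE cmulZl; congr (_ *: _).
    rewrite /g cmulBr cmulDl cmulBl cmulA.
    rewrite [in RHS]opprB [in RHS]opprB [RHS]addrCA [y + (_ - y)]addrC subrK.
    by rewrite addrA addrAC.
  rewrite {1}/g eyE; move: (g - h ∙ g) => z.
  by rewrite rmorphB/= scalerBl scale1r scalerBr opprB addrA addrAC.
have : nrm g <= (1 - q) * nrm y + q * nrm g.
  rewrite {1}gE (le_trans (nrmD _ _))// !nrmZR !ger0_norm ?subr_ge0 ?(ltW q1)//.
  by rewrite lerD// ler_wpM2l.
rewrite -lerBlDr -{1}[nrm g]mul1r -mulrBl ler_pM2l// subr_gt0//.
Qed.

Lemma cmul_defect e x : e^† = e ->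
  (x - e ∙ x) ∙ (x - e ∙ x)^† = (x ∙ x^† - e ∙ (x ∙ x^†)) -
     (x ∙ x^† - e ∙ (x ∙ x^†)) ∙ e.
Proof.
by move=> ee; rewrite cstarB cstarM ee cmulBr cmulA !cmulBl !cmulA.
Qed.

Definition is_approx_unit e :=
  e^† = e /\ forall y, nrm (y - e ∙ y) <= nrm y.

Lemma approx_unit_r e y : is_approx_unit e -> nrm (y - y ∙ e) <= nrm y.
Proof.
move=> [ee le]; rewrite -nrm_cstar cstarB cstarM ee (le_trans (le _))//.
by rewrite nrm_cstar.
Qed.

Lemma approx_unit_defect e x : is_approx_unit e ->
  nrm (x - e ∙ x) ^+ 2 <= nrm (x ∙ x^† - e ∙ (x ∙ x^†)).
Proof.
move=> ue; rewrite -nrm_Mcstar cmul_defect; last by case: ue.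
exact: approx_unit_r.
Qed.

Lemma ex_approx_unit_self I a (d : R) : ideal_set I a -> a^† = a -> 0 < d ->
  exists e, [/\ ideal_set I e, is_approx_unit e & nrm (a - e ∙ a) <= d].
Proof.
move=> Ia aa d0; pose M := nrm a + 1.
have M0 : 0 < M by rewrite ltr_wpDl ?nrm_ge0.
pose b := (M^-1)%:C *: a.
have nb : nrm b < 1.
  rewrite nrmZR gtr0_norm ?invr_gt0// mulrC ltr_pdivrMr// mul1r.
  by rewrite ltrDl.
have bb : b^† = b by rewrite cstarZR aa.
have Ib : ideal_set I b by exact: idealZ.
have hle y : nrm (y - b ∙ b ∙ y) <= nrm y by exact: nrm_sub_square.
pose t : R := Num.min 2^-1 ((d / M) ^+ 2 / 4).
have dM : 0 < d / M by rewrite divr_gt0.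
have t0 : 0 < t by rewrite lt_min invr_gt0 ltr0n/= divr_gt0 ?exprn_gt0.
have t2 : t <= 2^-1 by rewrite ge_min lexx.
have t4 : t <= (d / M) ^+ 2 / 4 by rewrite ge_min lexx orbT.
have q01 : 0 <= 1 - t < 1 by apply/andP; split; lra.
have Ih : ideal_set I (b ∙ b) by exact: idealMl.
have hh : (b ∙ b)^† = b ∙ b by rewrite cstarM bb.
have [e [Ie ee eh eE]] := ex_resolvent Ih hh hle q01.
have ue : is_approx_unit e.
  by split=> // y; exact: nrm_sub_resolvent eE.
exists e; split=> //.
have ne : nrm e <= 2.
  have : nrm e ^+ 2 <= 2 * nrm e.
    rewrite -nrm_cstarM ee -[e ∙ e](subKr e) (le_trans (nrmB _ _))//.
    by rewrite mulr_natl mulr2n lerD// ue.2.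
  have [->|e0] := eqVneq (nrm e) 0; first by [].
  by rewrite expr2 ler_pM2r// lt_neqAle eq_sym e0 nrm_ge0.
have hE : (1 - t)%:C *: (b ∙ b - e ∙ (b ∙ b)) = t%:C *: e.
  rewrite eh; apply: (addIr ((1 - t)%:C *: e)).
  rewrite -scalerDr -scalerDl -rmorphD/= [t + _]addrC subrK scale1r [RHS]eE.
  by congr (_ *: _); rewrite -addrA; congr (_ + _); rewrite addrC.
have bd : nrm (b ∙ b - e ∙ (b ∙ b)) <= (d / M) ^+ 2.
  have := congr1 (@nrm _ _) hE; rewrite !nrmZR.
  rewrite !ger0_norm ?(ltW t0)//; last by lra.
  have := nrm_ge0 (b ∙ b - e ∙ (b ∙ b)); nra.
have : nrm (b - e ∙ b) <= d / M.
  rewrite -(@ler_pXn2r _ 2) ?nnegrE ?nrm_ge0 ?(ltW dM)//.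
  by rewrite (le_trans (approx_unit_defect _ ue))// bb.
rewrite /b cmulZr -scalerBr nrmZR gtr0_norm ?invr_gt0//.
by rewrite [M^-1 * _]mulrC ler_pM2r ?invr_gt0.
Qed.

Lemma ex_approx_unit I x (d : R) : ideal_set I x -> 0 < d ->
  exists e, [/\ ideal_set I e, is_approx_unit e & nrm (x - e ∙ x) <= d].
Proof.
move=> Ix d0.
have Ia : ideal_set I (x ∙ x^†) by exact: idealMr.
have aa : (x ∙ x^†)^† = x ∙ x^† by rewrite cstarM cstarK.
have [e [Ie ue ea]] := ex_approx_unit_self Ia aa (exprn_gt0 2 d0).
exists e; split=> //; rewrite -(@ler_pXn2r _ 2) ?nnegrE ?nrm_ge0 ?(ltW d0)//.
exact: le_trans (approx_unit_defect _ ue) ea.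
Qed.

Lemma ideal_star I x : ideal_set I x -> ideal_set I x^†.
Proof.
move=> Ix; apply: (closed_nrm (@ideal_closed _ _ I)) => d d0.
have d2 : 0 < d / 2 by rewrite divr_gt0.
have [e [Ie [ee _] xe]] := ex_approx_unit Ix d2.
exists (x^† ∙ e); first exact: idealMl.
rewrite -nrm_cstar cstarB cstarM cstarK ee (le_lt_trans xe)//.
by rewrite ltr_pdivrMr// ltr_pMr// ltr1n.
Qed.

End ApproximateUnit.

(* The quotient B / I: the additive quotient group, with operations induced
   by those of B, and the quotient norm |p| = inf {|b| : b a representative of p}. *)
Section QuotientAlgebra.
Variables (R : realType) (B : cstarAlgType R) (I : ideal B).

Definition ideal_pred : {pred B} := [pred x | `[< ideal_set I x >]].

Lemma ideal_predP x : reflect (ideal_set I x) (x \in ideal_pred).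
Proof. exact: asboolP. Qed.

Fact ideal_zmod_closed : zmod_closed ideal_pred.
Proof.
split=> [|x y]; first exact/ideal_predP/ideal0.
by move=> /ideal_predP Ix /ideal_predP Iy; apply/ideal_predP/idealB.
Qed.

HB.instance Definition _ :=
  GRing.isZmodClosed.Build B ideal_pred ideal_zmod_closed.

Definition quot : Type := Quotient.quot ideal_pred.

HB.instance Definition _ := GRing.Zmodule.on quot.

Definition quot_pi (b : B) : quot := (\pi_(Quotient.quot ideal_pred) b)%qT.
Definition quot_repr (p : quot) : B := repr (p : Quotient.quot ideal_pred).

Implicit Types (a b c : B) (p q : quot).

Lemma quot_reprK p : quot_pi (quot_repr p) = p.
Proof. exact: reprK. Qed.

Lemma quot_piP a b : quot_pi a = quot_pi b <-> ideal_set I (a - b).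
Proof.
split=> [ab|/ideal_predP]; last by rewrite Quotient.idealrBE => /eqP.
by apply/ideal_predP; rewrite Quotient.idealrBE; exact/eqP.
Qed.

Lemma quot_pi_sub a b : ideal_set I b -> quot_pi (a - b) = quot_pi a.
Proof. by move=> Ib; apply/quot_piP; rewrite addrAC subrr sub0r; exact: idealN. Qed.

Lemma quot_reprB a : ideal_set I (quot_repr (quot_pi a) - a).
Proof. by apply/quot_piP; rewrite quot_reprK. Qed.

Lemma quot_piD a b : quot_pi (a + b) = quot_pi a + quot_pi b.
Proof. exact: Quotient.pi_add. Qed.

Lemma quot_piN a : quot_pi (- a) = - quot_pi a.
Proof. exact: Quotient.pi_opp. Qed.

Lemma quot_piB a b : quot_pi (a - b) = quot_pi a - quot_pi b.
Proof. by rewrite quot_piD quot_piN. Qed.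

Lemma quot_pi0 : quot_pi 0 = 0.
Proof. by rewrite -(subrr 0) quot_piB subrr. Qed.

Lemma quot_pi_eq0 a : quot_pi a = 0 <-> ideal_set I a.
Proof. by rewrite -quot_pi0 quot_piP subr0. Qed.

Definition quot_scale (k : R[i]) p := quot_pi (k *: quot_repr p).
Definition quot_mul p q := quot_pi (quot_repr p ∙ quot_repr q).
Definition quot_star p := quot_pi (quot_repr p)^†.
Definition qnrm p : R := inf [set nrm b | b in [set b | quot_pi b = p]].
Definition quot_norm p : R[i] := (qnrm p)%:C.

Lemma quot_piZ k a : quot_pi (k *: a) = quot_scale k (quot_pi a).
Proof.
apply/esym/quot_piP; rewrite -scalerBr; apply: idealZ; exact: quot_reprB.
Qed.

Lemma quot_piM a b : quot_pi (a ∙ b) = quot_mul (quot_pi a) (quot_pi b).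
Proof.
apply/esym/quot_piP; rewrite -[_ - _](subrKA (a ∙ quot_repr (quot_pi b))).
rewrite -cmulBl -cmulBr; apply: idealD.
  by apply: idealMr; exact: quot_reprB.
by apply: idealMl; exact: quot_reprB.
Qed.

Lemma quot_piS a : quot_pi a^† = quot_star (quot_pi a).
Proof.
apply/esym/quot_piP; rewrite -cstarB; apply: ideal_star; exact: quot_reprB.
Qed.

Lemma quot_ind (P : quot -> Prop) : (forall a, P (quot_pi a)) -> forall p, P p.
Proof. by move=> Ppi p; rewrite -(quot_reprK p). Qed.

Fact quot_scaleA k l p : quot_scale k (quot_scale l p) = quot_scale (k * l) p.
Proof. by elim/quot_ind: p => a; rewrite -!quot_piZ scalerA. Qed.

Fact quot_scale1 : left_id 1 quot_scale.
Proof. by elim/quot_ind => a; rewrite -quot_piZ scale1r. Qed.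

Fact quot_scaleDr : right_distributive quot_scale +%R.
Proof.
move=> k; elim/quot_ind => a; elim/quot_ind => b.
by rewrite -quot_piD -!quot_piZ scalerDr quot_piD.
Qed.

Fact quot_scaleDl p : {morph quot_scale^~ p : k l / k + l}.
Proof.
by elim/quot_ind: p => a k l; rewrite -!quot_piZ scalerDl quot_piD.
Qed.

HB.instance Definition _ := GRing.Zmodule_isLmodule.Build R[i] quot
  quot_scaleA quot_scale1 quot_scaleDr quot_scaleDl.

Lemma qnrm_le b : qnrm (quot_pi b) <= nrm b.
Proof.
apply: ge_inf; last by exists b.
by exists 0 => _ [c _ <-]; exact: nrm_ge0.
Qed.

Lemma qnrm_set0 p : [set nrm b | b in [set b | quot_pi b = p]] !=set0.
Proof. by exists (nrm (quot_repr p)), (quot_repr p) => //; exact: quot_reprK. Qed.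

Lemma qnrm_lt p (d : R) : qnrm p < d -> exists2 b, quot_pi b = p & nrm b < d.
Proof. by case/(inf_lt (qnrm_set0 p)) => _ [b bp <-] bd; exists b. Qed.

Lemma qnrm_lift p (d : R) : 0 < d ->
  exists2 b, quot_pi b = p & nrm b < qnrm p + d.
Proof. by move=> d0; apply: qnrm_lt; rewrite ltrDl. Qed.

Lemma qnrm_ge0 p : 0 <= qnrm p.
Proof.
apply: lb_le_inf; first exact: qnrm_set0.
by move=> _ [b _ <-]; exact: nrm_ge0.
Qed.

Lemma qnrmD p q : qnrm (p + q) <= qnrm p + qnrm q.
Proof.
apply/ler_addgt0Pr => d d0; have d2 : 0 < d / 2 by rewrite divr_gt0.
have [[a <- ap] [b <- bq]] := (qnrm_lift p d2, qnrm_lift q d2).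
rewrite -quot_piD (le_trans (qnrm_le _))// (le_trans (nrmD _ _))//; lra.
Qed.

Lemma qnrmZ_le (k : R[i]) p : qnrm (k *: p) <= complex.Re `|k| * qnrm p.
Proof.
have [kE k0] : `|k| = (complex.Re `|k|)%:C /\ 0 <= complex.Re `|k|.
  have kE : `|k| = (complex.Re `|k|)%:C by rewrite RRe_real.
  by split=> //; rewrite -lecR -kE normr_ge0.
set r := complex.Re _ in k0 *.
apply/ler_addgt0Pr => d d0.
have r1 : 0 < r + 1 by rewrite ltr_wpDl.
have d2 : 0 < d / (r + 1) by rewrite divr_gt0.
have [a ap ad] := qnrm_lift p d2.
have -> : k *: p = quot_pi (k *: a) by rewrite quot_piZ ap.
rewrite (le_trans (qnrm_le _))// nrmZ -/r.
rewrite (le_trans (ler_wpM2l k0 (ltW ad)))// mulrDr lerD2l mulrCA.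
by rewrite ger_pMr// ler_pdivrMr// mul1r lerDl.
Qed.

Fact quot_normD p q : quot_norm (p + q) <= quot_norm p + quot_norm q.
Proof. by rewrite /quot_norm -rmorphD lecR qnrmD. Qed.

Fact quot_normZ (k : R[i]) p : quot_norm (k *: p) = `|k| * quot_norm p.
Proof.
have nE (l : R[i]) : `|l| = (complex.Re `|l|)%:C by rewrite RRe_real.
rewrite /quot_norm nE -rmorphM; congr (_%:C); apply/eqP.
rewrite eq_le qnrmZ_le andTb.
have [->|k0] := eqVneq k 0.
  by rewrite normr0/= mul0r qnrm_ge0.
have nk0 : 0 < complex.Re `|k| by rewrite -ltcR -nE normr_gt0.
rewrite -ler_pdivlMl// -{1}[p]scale1r -(mulVf k0) -scalerA.
rewrite (le_trans (qnrmZ_le _ _))// normfV nE -fmorphV/=.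
by [].
Qed.

Fact quot_norm0_eq0 p : quot_norm p = 0 -> p = 0.
Proof.
elim/quot_ind: p => a /complexI na; apply/quot_pi_eq0.
apply: (closed_nrm (@ideal_closed _ _ I)) => d d0.
have [|b ba bd] := @qnrm_lt (quot_pi a) d; first by rewrite na.
by exists (a - b); [apply/quot_piP; rewrite ba|rewrite subKr].
Qed.

HB.instance Definition _ := Lmodule_isNormed.Build R[i] quot
  quot_normD quot_normZ quot_norm0_eq0.

Lemma qnrmE p : nrm p = qnrm p.
Proof. by []. Qed.

Fact quot_complete (F : set_system quot) : ProperFilter F -> cauchy F -> cvg F.
Proof.
move=> FF Fc; pose s (n : nat) : R := 2^-1 ^+ n.
have s0 n : 0 < s n by rewrite exprn_gt0// invr_gt0.
have /choice[p Fp] n : exists p, F (ball p (s n)%:C).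
  by move/cauchyP : Fc; apply; rewrite ltcR.
have pd n : qnrm (p n.+1 - p n) < 2 * s n.
  have [q [/=]] := filter_ex (filterI (Fp n) (Fp n.+1)).
  rewrite -!ball_normE/= !nrmE !ltcR => pq p'q.
  have := nrm_triangle q (p n.+1) (p n); rewrite [nrm (q - _)]nrmBC -!qnrmE.
  have sS : s n.+1 = 2^-1 * s n by rewrite /s exprS.
  have := s0 n; rewrite sS in p'q; lra.
have /choice[d dp] n : exists d, quot_pi d = p n.+1 - p n /\ nrm d < 2 * s n.
  by have [d dp ds] := qnrm_lt (pd n); exists d.
pose u n := quot_repr (p 0) + \sum_(i < n) d i.
have up n : quot_pi (u n) = p n.
  elim: n => [|n IH]; first by rewrite /u big_ord0 addr0 quot_reprK.
  by rewrite /u big_ord_recr/= addrA quot_piD IH (dp n).1 addrC subrK.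
have half : 0 <= (2^-1 : R) < 1 by apply/andP; split; lra.
have ud n : nrm (u n.+1 - u n) <= 2 * 2^-1 ^+ n.
  rewrite /u big_ord_recr/= addrA [X in nrm X]addrAC subrr add0r.
  exact/ltW/(dp n).2.
have [//|l lu] := fast_cauchy _ half ud.
apply/cvg_ex; exists (quot_pi l); apply/cvg_ballP => _ /cplx_gt0[e e0 ->].
have [n ne] := expr_small 5 half e0.
apply: filterS (Fp n) => q; rewrite -!ball_normE/= !nrmE !ltcR => pq.
apply: le_lt_trans (nrm_triangle (p n) _ _) _.
have : nrm (quot_pi l - p n) <= 4 * s n.
  rewrite qnrmE -(up n) -quot_piB (le_trans (qnrm_le _))// (le_trans (lu n))//.
  rewrite /s; have : 0 <= (2^-1 : R) ^+ n by rewrite exprn_ge0.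
  by rewrite (_ : 1 - 2^-1 = 2^-1 :> R) ?invrK; lra.
move: pq ne; rewrite /s; lra.
Qed.

HB.instance Definition _ := Uniform_isComplete.Build quot quot_complete.

Fact quot_mulA : associative quot_mul.
Proof.
elim/quot_ind => a; elim/quot_ind => b; elim/quot_ind => c.
by rewrite -!quot_piM cmulA.
Qed.

Fact quot_mulDl : left_distributive quot_mul +%R.
Proof.
elim/quot_ind => a; elim/quot_ind => b; elim/quot_ind => c.
by rewrite -quot_piD -!quot_piM cmulDl quot_piD.
Qed.

Fact quot_mulDr : right_distributive quot_mul +%R.
Proof.
elim/quot_ind => a; elim/quot_ind => b; elim/quot_ind => c.
by rewrite -quot_piD -!quot_piM cmulDr quot_piD.
Qed.

Fact quot_mulZl (k : R[i]) p q : quot_mul (k *: p) q = k *: quot_mul p q.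
Proof.
elim/quot_ind: p => a; elim/quot_ind: q => b.
by rewrite -[k *: quot_pi a]quot_piZ -!quot_piM cmulZl quot_piZ.
Qed.

Fact quot_mulZr (k : R[i]) p q : quot_mul p (k *: q) = k *: quot_mul p q.
Proof.
elim/quot_ind: p => a; elim/quot_ind: q => b.
by rewrite -[k *: quot_pi b]quot_piZ -!quot_piM cmulZr quot_piZ.
Qed.

Fact quot_starD : {morph quot_star : p q / p + q}.
Proof.
elim/quot_ind => a; elim/quot_ind => b.
by rewrite -quot_piD -!quot_piS cstarD quot_piD.
Qed.

Fact quot_starZ (k : R[i]) p : quot_star (k *: p) = k^* *: quot_star p.
Proof.
elim/quot_ind: p => a.
by rewrite -[k *: quot_pi a]quot_piZ -!quot_piS cstarZ quot_piZ.
Qed.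

Fact quot_starM p q :
  quot_star (quot_mul p q) = quot_mul (quot_star q) (quot_star p).
Proof.
elim/quot_ind: p => a; elim/quot_ind: q => b.
by rewrite -quot_piM -!quot_piS cstarM quot_piM.
Qed.

Fact quot_starK : involutive quot_star.
Proof. by elim/quot_ind => a; rewrite -!quot_piS cstarK. Qed.

Lemma qnrmM p q : qnrm (quot_mul p q) <= qnrm p * qnrm q.
Proof.
apply/ler_addgt0Pr => d d0.
pose m := qnrm p + qnrm q + 1.
have p0 := qnrm_ge0 p; have q0 := qnrm_ge0 q.
have m0 : 0 < m by rewrite /m; lra.
pose t := Num.min 1 (d / m).
have t0 : 0 < t by rewrite lt_min ltr01 divr_gt0.
have t1 : t <= 1 by rewrite ge_min lexx.
have td : t * m <= d by rewrite -ler_pdivlMr// ge_min lexx orbT.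
have [a ap ad] := qnrm_lift p t0; have [b bq bd] := qnrm_lift q t0.
rewrite -{1}ap -{1}bq -quot_piM (le_trans (qnrm_le _))//.
rewrite (le_trans (nrmM _ _))//.
apply: (@le_trans _ _ ((qnrm p + t) * (qnrm q + t))).
  by rewrite ler_pM ?nrm_ge0 ?ltW.
rewrite /m in td; nra.
Qed.

Lemma qnrm_star_le p : qnrm (quot_star p) <= qnrm p.
Proof.
apply/ler_addgt0Pr => d /(qnrm_lift p)[a ap ad].
rewrite -{1}ap -quot_piS (le_trans (qnrm_le _))// nrm_cstar.
exact: ltW.
Qed.

Lemma qnrm_starM p : qnrm (quot_mul (quot_star p) p) = qnrm p ^+ 2.
Proof.
apply/eqP; rewrite eq_le; apply/andP; split.
  rewrite (le_trans (qnrmM _ _))// expr2 ler_wpM2r ?qnrm_ge0//.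
  exact: qnrm_star_le.
apply/ler_addgt0Pr => d d0; have d2 : 0 < d / 2 by rewrite divr_gt0.
elim/quot_ind: p => x; set p := quot_pi x.
have [b bp bd] := qnrm_lift (quot_mul (quot_star p) p) d2.
have Ij : ideal_set I (b - x^† ∙ x).
  by apply/quot_piP; rewrite bp quot_piM quot_piS.
have [e [Ie ue ed]] := ex_approx_unit Ij d2.
have px : qnrm p <= nrm (x^† - e ∙ x^†).
  rewrite -nrm_cstar cstarB cstarM cstarK ue.1.
  rewrite /p -(@quot_pi_sub x (x ∙ e)); last exact: idealMl.
  exact: qnrm_le.
apply: (@le_trans _ _ (nrm (x^† - e ∙ x^†) ^+ 2)).
  by rewrite ler_pXn2r ?nnegrE ?qnrm_ge0 ?nrm_ge0.
rewrite (le_trans (approx_unit_defect _ ue))// cstarK.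
set j := b - _ in Ij ed; have -> : x^† ∙ x = b - j by rewrite subKr.
clearbody j.
have -> : b - j - e ∙ (b - j) = (b - e ∙ b) - (j - e ∙ j).
  by rewrite cmulBr !opprB addrACA [RHS]addrACA [- j - _]addrC.
have := nrmB (b - e ∙ b) (j - e ∙ j); have := ue.2 b; lra.
Qed.

Fact quot_normM p q : `|quot_mul p q| <= `|p| * `|q|.
Proof. by rewrite !nrmE -rmorphM/= lecR !qnrmE qnrmM. Qed.

Fact quot_norm_starM p : `|quot_mul (quot_star p) p| = `|p| ^+ 2.
Proof. by rewrite !nrmE -rmorphXn/= !qnrmE qnrm_starM. Qed.

HB.instance Definition _ := NormedModule_isCStarAlgebra.Build R quot
  quot_mulA quot_mulDl quot_mulDr quot_mulZl quot_mulZr quot_starD quot_starZ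
  quot_starM quot_starK quot_normM quot_norm_starM.

End QuotientAlgebra.

Section Homomorphisms.
Variable R : realType.

Record starHom (A B : cstarAlgType R) := StarHom {
  hom_fun :> A -> B;
  hom_linear : linear hom_fun;
  homM : forall x y, hom_fun (x ∙ y) = hom_fun x ∙ hom_fun y;
  homS : forall x, hom_fun x^† = (hom_fun x)^†
}.

HB.instance Definition _ (A B : cstarAlgType R) (phi : starHom A B) :=
  GRing.isLinear.Build R[i] A B *:%R (hom_fun phi) (hom_linear phi).

HB.instance Definition _ (A B : cstarAlgType R) := gen_eqMixin (starHom A B).
HB.instance Definition _ (A B : cstarAlgType R) := gen_choiceMixin (starHom A B).

(* The point-norm topology. *)
Section PointNorm.
Variables A B : cstarAlgType R.
Implicit Types phi psi : starHom A B.

Definition hom_ball phi (F : {fset A}) (eps : R) : set (starHom A B) :=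
  [set psi | forall a, a \in F -> `|psi a - phi a| < eps%:C].

Definition hom_nbhs phi : set_system (starHom A B) :=
  [set U | exists (F : {fset A}) (eps : R), 0 < eps /\ hom_ball phi F eps `<=` U].

Lemma hom_ball_center phi (F : {fset A}) (eps : R) :
  0 < eps -> hom_ball phi F eps phi.
Proof. by move=> e0 a _; rewrite subrr normr0 ltcR. Qed.

Fact hom_nbhs_filter phi : ProperFilter (hom_nbhs phi).
Proof.
split; first by move=> [F [e [e0 F0]]]; apply: (F0 phi); exact: hom_ball_center.
split=> [|U V [F [e [e0 FU]]] [G [d [d0 GV]]]|U V UV [F [e [e0 FU]]]].
- by exists fset0, 1; split.
- exists (F `|` G)%fset, (Num.min e d); split; first by rewrite lt_min e0.
  move=> psi H; split; [apply: FU|apply: GV] => a aF.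
    have : `|psi a - phi a| < (Num.min e d)%:C by apply: H; rewrite inE aF.
    by move/lt_le_trans; apply; rewrite lecR ge_min lexx.
  have : `|psi a - phi a| < (Num.min e d)%:C by apply: H; rewrite inE aF orbT.
  by move/lt_le_trans; apply; rewrite lecR ge_min lexx orbT.
- by exists F, e; split=> //; exact: subset_trans UV.
Qed.

Fact hom_nbhs_singleton phi (U : set (starHom A B)) : hom_nbhs phi U -> U phi.
Proof. by move=> [F [e [e0 FU]]]; apply: FU; exact: hom_ball_center. Qed.

Fact hom_nbhs_nbhs phi (U : set (starHom A B)) :
  hom_nbhs phi U -> hom_nbhs phi (hom_nbhs^~ U).
Proof.
move=> [F [e [e0 FU]]]; have e2 : 0 < e / 2 by rewrite divr_gt0.
exists F, (e / 2); split=> // psi Fpsi; exists F, (e / 2); split=> // xi Fxi.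
apply: FU => a aF; rewrite -(subrKA (psi a)) (le_lt_trans (ler_normD _ _))//.
by rewrite (splitr e) rmorphD ltrD ?Fxi ?Fpsi.
Qed.

HB.instance Definition _ := hasNbhs.Build (starHom A B) hom_nbhs.
HB.instance Definition _ := Nbhs_isNbhsTopological.Build (starHom A B)
  hom_nbhs_filter hom_nbhs_singleton hom_nbhs_nbhs.

End PointNorm.

Lemma hom_ext (A B : cstarAlgType R) (phi psi : starHom A B) :
  phi =1 psi -> phi = psi.
Proof.
case: phi psi => [f fl fM fS] [g gl gM gS] /= /funext fg; subst g.
by congr StarHom; exact: Prop_irrelevance.
Qed.

Section Composition.
Variables A B C : cstarAlgType R.
Variables (psi : starHom B C) (phi : starHom A B).

Fact hom_comp_linear : linear (psi \o phi).
Proof. by move=> k x y /=; rewrite !hom_linear. Qed.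

Fact hom_compM x y : (psi \o phi) (x ∙ y) = (psi \o phi) x ∙ (psi \o phi) y.
Proof. by rewrite /= !homM. Qed.

Fact hom_compS x : (psi \o phi) x^† = ((psi \o phi) x)^†.
Proof. by rewrite /= !homS. Qed.

Definition hom_comp : starHom A C := StarHom hom_comp_linear hom_compM hom_compS.

End Composition.

Section QuotientMap.
Variables (B : cstarAlgType R) (I : ideal B).

Fact quot_pi_linear : linear (@quot_pi R B I).
Proof. by move=> k x y; rewrite quot_piD quot_piZ. Qed.

Definition quot_hom : starHom B (quot I) :=
  StarHom quot_pi_linear (@quot_piM R B I) (@quot_piS R B I).

End QuotientMap.

Definition is_lift (A B : cstarAlgType R) (I : ideal B)
    (phibar : starHom A B) (phi : starHom A (quot I)) :=
  phi = hom_comp (quot_hom I) phibar.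

Definition liftable (A B : cstarAlgType R) (I : ideal B) : set (starHom A (quot I)) :=
  [set phi | exists phibar, is_lift phibar phi].

Definition l_open (A : cstarAlgType R) :=
  forall (B : cstarAlgType R) (I : ideal B), open (@liftable A B I).

Definition uniformly_open (A : cstarAlgType R) :=
  forall (eps : R) (F : {fset A}), 0 < eps ->
  exists (delta : R) (G : {fset A}), 0 < delta /\
    forall (B : cstarAlgType R) (J : ideal B) (gamma phi : starHom A (quot J))
           (gammabar : starHom A B),
      (forall u, u \in G -> `|gamma u - phi u| < delta%:C) ->
      is_lift gammabar gamma ->
      exists phibar : starHom A B, is_lift phibar phi /\
        forall v, v \in F -> `|gammabar v - phibar v| < eps%:C.

(* A path is given by a function on R; only its restriction to [0, 1] matters. *)
Definition homotopy_lifting (A : cstarAlgType R) :=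
  forall (B : cstarAlgType R) (I : ideal B) (phi : R -> starHom A (quot I))
         (phibar0 : starHom A B),
    {within `[0, 1], continuous phi} -> is_lift phibar0 (phi 0) ->
    exists phibar : R -> starHom A B,
      [/\ {within `[0, 1], continuous phibar}, phibar 0 = phibar0 &
          forall t, t \in `[0, 1] -> is_lift (phibar t) (phi t)].

Definition path_connected (T : topologicalType) (V : set T) :=
  forall x y, V x -> V y -> exists gamma : R -> T,
    [/\ {within `[0, 1], continuous gamma}, gamma 0 = x, gamma 1 = y &
        forall t, t \in `[0, 1] -> V (gamma t)].

Definition locally_path_connected (T : topologicalType) :=
  forall (x : T) (U : set T), nbhs x U ->
    exists V : set T, [/\ open V, V x, V `<=` U & path_connected V].

End Homomorphisms.

(* Main.v *)
Require Import Defs.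
From HB Require Import structures.
From mathcomp Require Import all_boot all_order all_algebra.
From mathcomp Require Import complex finmap lra ring.
From mathcomp Require Import all_classical all_reals all_analysis.

(* (i) => (ii). If uniform openness fails for eps and F, choose for every index
   i = (n, G), with n a natural number and G a finite subset of A, a
   counterexample (B_i, J_i, gamma_i, phi_i, gammabar_i) whose gamma_i and phi_i
   are 1/(n+1)-close on G. In the product of the B_i take the ideal of the
   families in the J_i that tend to 0 along i. Modulo this ideal, (gammabar_i) is
   a liftable *-homomorphism, and it is the limit of the *-homomorphisms that lift
   phi_i for late i and equal gammabar_i otherwise. So one of these is liftable,
   and its lifts approach gammabar_i: a contradiction.
   (ii) => (iii). Both parts of (iii) apply (ii) to algebras of bounded continuous
   functions on the real line. For short paths the ideal consists of the functions
   vanishing at both ends; for homotopies, of the functions vanishing up to s and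
   with values in I after s, which extends a lifted path by a short amount.
   (iii) => (i). A *-homomorphism close to a liftable one is joined to it by a
   path, and the path can be lifted. *)

Set Implicit Arguments.
Unset Strict Implicit.
Unset Printing Implicit Defensive.

Import Order.TTheory GRing.Theory Num.Theory.
Import numFieldNormedType.Exports.

Local Open Scope classical_set_scope.
Local Open Scope complex_scope.
Local Open Scope ring_scope.
Local Open Scope cstar_scope.

(** * Contractivity of *-homomorphisms *)

Section Contractive.
Variable R : realType.

Lemma nrm_closed_closed (V : normedModType R[i]) (S : set V) :
  nrm_closed S -> closed S.
Proof.
move=> cS x xS; apply: cS => e e0.
have /xS[y [Sy]] : nbhs x (ball x e%:C).
  by apply: nbhsx_ballx; rewrite ltcR.
by rewrite -ball_normE/= nrmE ltcR => xy; exists y.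
Qed.

(* In the unitization, [1 - a^2 = (1 - r)^2], so [a] and [1 - r] are the real
   and imaginary parts of unitaries. *)
Lemma nrm_mul_sqrt (B : cstarAlgType R) (a r y : B) :
  a^† = a -> r^† = r -> r ∙ a = a ∙ r -> r + r = a ∙ a + r ∙ r ->
  nrm (a ∙ y) <= nrm y.
Proof.
move=> aa rr ra ar; set w := y - r ∙ y; set p := a ∙ y.
have pw : p^† ∙ w = w^† ∙ p.
  rewrite /p /w cstarM cstarB cstarM aa rr -cmulA cmulBl -!cmulA -cmulBr.
  by congr (_ ∙ _); rewrite cmulBr !cmulA ra.
have pwy : p^† ∙ p + w^† ∙ w = y^† ∙ y.
  rewrite /p {1}/w cstarM cstarB cstarM aa rr cmulBl -!cmulA -cmulBr -cmulDr.
  congr (_ ∙ _); rewrite cmulBr !cmulA.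
  have -> : a ∙ a = r + r - r ∙ r by rewrite ar addrK.
  rewrite cmulBl cmulDl opprB [y - _ + _]addrACA -opprD [LHS]addrC subrKA.
  by rewrite addrK.
have cross (k : R[i]) : k^* = - k -> k * k = -1 -> nrm (p + k *: w) = nrm y.
  move=> kc kk; apply/eqP; rewrite -(@eqrXn2 _ 2) ?nrm_ge0//.
  by rewrite nrm_cross// pwy nrm_cstarM.
have ii : 'i * 'i = -1 :> R[i] by rewrite -expr2 sqrCi.
have k1 := cross 'i (conjCi _) ii.
have k2 : nrm (p + (- 'i) *: w) = nrm y.
  by apply: cross; rewrite ?rmorphN/= ?conjCi// mulrNN.
have : nrm ((p + 'i *: w) + (p + (- 'i) *: w)) <= nrm y + nrm y.
  by rewrite (le_trans (nrmD _ _))// k1 k2.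
rewrite addrACA scaleNr subrr addr0.
have -> : p + p = (2 : R)%:C *: p by rewrite rmorphD scalerDl scale1r.
rewrite nrmZR ger0_norm//; lra.
Qed.

(** For a self-adjoint [x] of norm below 1, the relations between [x] and the [r] of [ex_sqrt] are
    algebraic, so [phi] preserves them and left multiplication by [phi x] is contractive. Applied to
    [phi x] itself this gives [|phi x|^2 <= |phi x|]. Scaling and the C*-identity yield the general
    case. *)
Lemma starHom_nrm_le (A B : cstarAlgType R) (phi : starHom A B) a :
  nrm (phi a) <= nrm a.
Proof.
have unit_ball (x : A) : x^† = x -> nrm x < 1 -> nrm (phi x) <= 1.
  move=> xx x1; have [r [rr rx xr]] := ex_sqrt xx x1.
  have := @nrm_mul_sqrt B (phi x) (phi r) (phi x).
  rewrite -!homS xx rr -!homM rx -!linearD xr => /(_ erefl erefl erefl erefl).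
  rewrite homM -{1}xx homS nrm_cstarM.
  have := nrm_ge0 (phi x); nra.
have self x : x^† = x -> nrm (phi x) <= nrm x.
  move=> xx; apply/ler_addgt0Pr => e e0.
  have M0 : 0 < nrm x + e by rewrite ltr_wpDl ?nrm_ge0.
  have := @unit_ball ((nrm x + e)^-1%:C *: x).
  rewrite cstarZR xx linearZ/= !nrmZR ger0_norm; last by rewrite invr_ge0 ltW.
  rewrite ![_^-1 * _]mulrC ltr_pdivrMr// ler_pdivrMr// mul1r ltrDl.
  by move=> /(_ erefl e0).
rewrite -(@ler_pXn2r _ 2) ?nnegrE ?nrm_ge0// -!nrm_cstarM -homS -homM.
by apply: self; rewrite cstarM cstarK.
Qed.

End Contractive.

(** * C*-algebras of bounded families *)

Section Families.
Variables (R : realType) (I : Type) (B : I -> cstarAlgType R).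

(** A common interface for the two kinds of algebra built below: products of many algebras and
    continuous paths in a single one. Boundedness makes the supremum norm finite, and stability
    under uniform limits makes it complete. *)
Record family_algebra := FamilyAlgebra {
  family_set :> (forall i, B i) -> Prop;
  family_bounded : forall f, family_set f -> exists M, forall i, nrm (f i) <= M;
  family0 : family_set (fun=> 0);
  familyD : forall f g, family_set f -> family_set g ->
    family_set (fun i => f i + g i);
  familyZ : forall (k : R[i]) f, family_set f -> family_set (fun i => k *: f i);
  familyM : forall f g, family_set f -> family_set g ->
    family_set (fun i => f i ∙ g i);
  familyS : forall f, family_set f -> family_set (fun i => (f i)^†);
  family_closed : forall f, (forall e : R, 0 < e ->
      exists2 g, family_set g & forall i, nrm (f i - g i) <= e) -> family_set f
}.

Variable S : family_algebra.

Record fam := Fam { fam_fun :> forall i, B i; famP : S fam_fun }.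

Lemma fam_ext (f g : fam) : (forall i, f i = g i) -> f = g.
Proof.
case: f g => [f Sf] [g Sg] /= fgE.
have fg := functional_extensionality_dep fgE; subst g.
by congr Fam; exact: Prop_irrelevance.
Qed.

HB.instance Definition _ := gen_eqMixin fam.
HB.instance Definition _ := gen_choiceMixin fam.

Lemma familyN f : S f -> S (fun i => - f i).
Proof.
move=> /(familyZ (-1)); congr (S _).
by apply: functional_extensionality_dep => i; rewrite scaleN1r.
Qed.

Definition fam_zero := Fam (family0 S).
Definition fam_opp (f : fam) := Fam (familyN (famP f)).
Definition fam_add (f g : fam) := Fam (familyD (famP f) (famP g)).
Definition fam_scale (k : R[i]) (f : fam) := Fam (familyZ k (famP f)).
Definition fam_mul (f g : fam) := Fam (familyM (famP f) (famP g)).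
Definition fam_star (f : fam) := Fam (familyS (famP f)).

Fact fam_addA : associative fam_add.
Proof. by move=> f g h; apply: fam_ext => i /=; rewrite addrA. Qed.
Fact fam_addC : commutative fam_add.
Proof. by move=> f g; apply: fam_ext => i /=; rewrite addrC. Qed.
Fact fam_add0 : left_id fam_zero fam_add.
Proof. by move=> f; apply: fam_ext => i /=; rewrite add0r. Qed.
Fact fam_addN : left_inverse fam_zero fam_opp fam_add.
Proof. by move=> f; apply: fam_ext => i /=; rewrite addNr. Qed.

HB.instance Definition _ :=
  GRing.isZmodule.Build fam fam_addA fam_addC fam_add0 fam_addN.

Fact fam_scaleA k l f : fam_scale k (fam_scale l f) = fam_scale (k * l) f.
Proof. by apply: fam_ext => i /=; rewrite scalerA. Qed.
Fact fam_scale1 : left_id 1 fam_scale.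
Proof. by move=> f; apply: fam_ext => i /=; rewrite scale1r. Qed.
Fact fam_scaleDr : right_distributive fam_scale +%R.
Proof. by move=> k f g; apply: fam_ext => i /=; rewrite scalerDr. Qed.
Fact fam_scaleDl f : {morph fam_scale^~ f : k l / k + l}.
Proof. by move=> k l; apply: fam_ext => i /=; rewrite scalerDl. Qed.

HB.instance Definition _ := GRing.Zmodule_isLmodule.Build R[i] fam
  fam_scaleA fam_scale1 fam_scaleDr fam_scaleDl.

Lemma famDE (f g : fam) i : (f + g) i = f i + g i. Proof. by []. Qed.
Lemma famBE (f g : fam) i : (f - g) i = f i - g i. Proof. by []. Qed.
Lemma famZE (k : R[i]) (f : fam) i : (k *: f) i = k *: f i. Proof. by []. Qed.

(* An infimum of upper bounds, so that the norm is also correct when [I] is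
   empty. *)
Definition fam_bounds (f : fam) : set R :=
  [set M | 0 <= M /\ forall i, nrm (f i) <= M].
Definition fnrm (f : fam) : R := inf (fam_bounds f).
Definition fam_norm (f : fam) : R[i] := (fnrm f)%:C.

Implicit Types f g : fam.

Lemma fam_bounds_has_inf f : has_inf (fam_bounds f).
Proof.
split; last by exists 0 => M [].
have [M fM] := family_bounded (famP f); exists `|M|; split=> // i.
exact: le_trans (fM i) (ler_norm _).
Qed.

Lemma fnrm_ge0 f : 0 <= fnrm f.
Proof. by apply: lb_le_inf; [case: (fam_bounds_has_inf f)|move=> M []]. Qed.

Lemma nrm_fam_le f i : nrm (f i) <= fnrm f.
Proof. by apply: lb_le_inf; [case: (fam_bounds_has_inf f)|move=> M []]. Qed.

Lemma fnrm_le f (M : R) : 0 <= M -> (forall i, nrm (f i) <= M) -> fnrm f <= M.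
Proof. by move=> M0 fM; apply: ge_inf => //; case: (fam_bounds_has_inf f). Qed.

Fact fam_normD f g : fam_norm (f + g) <= fam_norm f + fam_norm g.
Proof.
rewrite /fam_norm -rmorphD lecR fnrm_le ?addr_ge0 ?fnrm_ge0// => i.
by rewrite famDE (le_trans (nrmD _ _))// lerD// nrm_fam_le.
Qed.

Fact fam_normZ (k : R[i]) f : fam_norm (k *: f) = `|k| * fam_norm f.
Proof.
have kE (l : R[i]) : `|l| = (complex.Re `|l|)%:C by rewrite RRe_real.
have k0 (l : R[i]) : 0 <= complex.Re `|l| by rewrite -lecR -kE normr_ge0.
have le l g : fnrm (l *: g) <= complex.Re `|l| * fnrm g.
  apply: fnrm_le => [|i]; first by rewrite mulr_ge0 ?fnrm_ge0.
  by rewrite famZE nrmZ ler_wpM2l// nrm_fam_le.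
rewrite /fam_norm kE -rmorphM; congr (_%:C); apply/eqP.
rewrite eq_le le andTb.
have [->|kn0] := eqVneq k 0; first by rewrite normr0/= mul0r fnrm_ge0.
have nk0 : 0 < complex.Re `|k| by rewrite -ltcR -kE normr_gt0.
rewrite -ler_pdivlMl// -{1}[f]scale1r -(mulVf kn0) -scalerA.
by rewrite (le_trans (le _ _))// normfV kE -fmorphV/=.
Qed.

Fact fam_norm0_eq0 f : fam_norm f = 0 -> f = 0.
Proof.
move=> /complexI f0; apply: fam_ext => i; apply: nrm_eq0; apply/eqP.
by rewrite eq_le nrm_ge0 andbT -f0 nrm_fam_le.
Qed.

HB.instance Definition _ := Lmodule_isNormed.Build R[i] fam
  fam_normD fam_normZ fam_norm0_eq0.

Lemma fnrmE f : nrm f = fnrm f.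
Proof. by []. Qed.

(** Evaluations are contractive, so pointwise limits exist. The Cauchy estimates pass to them
    uniformly in the index, which places the limit family in [S] by [family_closed]. *)
Fact fam_complete (F : set_system fam) : ProperFilter F -> cauchy F -> cvg F.
Proof.
move=> FF Fc.
have near e : 0 < e -> exists g : fam, F [set f | fnrm (g - f) < e].
  move=> e0; have [|g Fg] := (cauchyP F).1 Fc e%:C; first by rewrite ltcR.
  exists g; apply: filterS Fg => f.
  by rewrite -ball_normE/= nrmE ltcR.
have Fi i : cvg ((fun f : fam => f i) @ F).
  apply: cauchy_cvg; apply/cauchy_exP => _ /cplx_gt0[e e0 ->].
  have [g Fg] := near _ e0; exists (g i).
  suff : F [set f | ball (g i) e%:C (f i)] by [].
  apply: filterS Fg => f /= gf; rewrite -ball_normE/= nrmE ltcR.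
  exact: le_lt_trans (nrm_fam_le (g - f) i) gf.
pose l i : B i := lim ((fun f : fam => f i) @ F).
have lE e g : F [set f | fnrm (g - f) < e] -> forall i, nrm (l i - g i) <= e.
  move=> Fg i; apply/ler_addgt0Pr => d d0.
  have /cvgrPdist_lt/(_ d%:C) := Fi i; rewrite ltcR => /(_ d0) Fl.
  have [f [/= gf]] := filter_ex (filterI Fg Fl).
  rewrite nrmE ltcR -/(l i) => lf.
  rewrite (le_trans (nrm_triangle (f i) _ _))// addrC lerD ?(ltW lf)//.
  by rewrite nrmBC (le_trans (nrm_fam_le (g - f) i))// ltW.
have Sl : S l.
  apply: family_closed => e /near[g Fg]; exists g; first exact: famP.
  exact: lE.
apply/cvg_ex; exists (Fam Sl); apply/cvgrPdist_lt => _ /cplx_gt0[e e0 ->].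
have e3 : 0 < e / 3 by rewrite divr_gt0.
have [g Fg] := near _ e3; have lg := lE _ _ Fg.
apply: filterS Fg => f /= gf; rewrite nrmE ltcR.
apply: le_lt_trans (nrm_triangle g _ _) _.
rewrite !fnrmE in gf *.
have : fnrm (Fam Sl - g) <= e / 3 by apply: fnrm_le; rewrite ?ltW.
move: gf; rewrite /=; lra.
Qed.

HB.instance Definition _ := Uniform_isComplete.Build fam fam_complete.

Fact fam_mulA : associative fam_mul.
Proof. by move=> f g h; apply: fam_ext => i /=; rewrite cmulA. Qed.
Fact fam_mulDl : left_distributive fam_mul +%R.
Proof. by move=> f g h; apply: fam_ext => i /=; rewrite cmulDl. Qed.
Fact fam_mulDr : right_distributive fam_mul +%R.
Proof. by move=> f g h; apply: fam_ext => i /=; rewrite cmulDr. Qed.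
Fact fam_mulZl (k : R[i]) f g : fam_mul (k *: f) g = k *: fam_mul f g.
Proof. by apply: fam_ext => i /=; rewrite cmulZl. Qed.
Fact fam_mulZr (k : R[i]) f g : fam_mul f (k *: g) = k *: fam_mul f g.
Proof. by apply: fam_ext => i /=; rewrite cmulZr. Qed.
Fact fam_starD : {morph fam_star : f g / f + g}.
Proof. by move=> f g; apply: fam_ext => i /=; rewrite cstarD. Qed.
Fact fam_starZ (k : R[i]) f : fam_star (k *: f) = k^* *: fam_star f.
Proof. by apply: fam_ext => i /=; rewrite cstarZ. Qed.
Fact fam_starM f g : fam_star (fam_mul f g) = fam_mul (fam_star g) (fam_star f).
Proof. by apply: fam_ext => i /=; rewrite cstarM. Qed.
Fact fam_starK : involutive fam_star.
Proof. by move=> f; apply: fam_ext => i /=; rewrite cstarK. Qed.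

Fact fam_normM f g : `|fam_mul f g| <= `|f| * `|g|.
Proof.
rewrite !nrmE -rmorphM/= lecR !fnrmE fnrm_le ?mulr_ge0 ?fnrm_ge0// => i /=.
by rewrite (le_trans (nrmM _ _))// ler_pM ?nrm_ge0 ?nrm_fam_le.
Qed.

Fact fam_norm_starM f : `|fam_mul (fam_star f) f| = `|f| ^+ 2.
Proof.
rewrite !nrmE -rmorphXn/= !fnrmE; congr (_%:C); apply/eqP.
rewrite eq_le; apply/andP; split.
  apply: fnrm_le => [|i /=]; first by rewrite exprn_ge0 ?fnrm_ge0.
  by rewrite nrm_cstarM ler_pXn2r ?nnegrE ?nrm_ge0 ?fnrm_ge0 ?nrm_fam_le.
(* Square roots isolate [fnrm f], so that it suffices to bound each coordinate. *)
rewrite -ler_sqrt ?fnrm_ge0// sqrtr_sqr ger0_norm ?fnrm_ge0//.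
apply: fnrm_le => [|i]; first exact: sqrtr_ge0.
rewrite -[nrm _]ger0_norm ?nrm_ge0// -sqrtr_sqr ler_sqrt ?fnrm_ge0//.
by rewrite -nrm_cstarM (nrm_fam_le (fam_mul (fam_star f) f) i).
Qed.

HB.instance Definition _ := NormedModule_isCStarAlgebra.Build R fam
  fam_mulA fam_mulDl fam_mulDr fam_mulZl fam_mulZr fam_starD fam_starZ
  fam_starM fam_starK fam_normM fam_norm_starM.

Section FamilyHom.
Variables (A : cstarAlgType R) (h : forall i, starHom A (B i)).
Hypothesis Sh : forall a, S (fun i => h i a).

Definition fam_hom_fun (a : A) := Fam (Sh a).

Fact fam_hom_linear : linear fam_hom_fun.
Proof. by move=> k x y; apply: fam_ext => i /=; rewrite hom_linear. Qed.
Fact fam_homM x y : fam_hom_fun (x ∙ y) = fam_hom_fun x ∙ fam_hom_fun y.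
Proof. by apply: fam_ext => i /=; rewrite homM. Qed.
Fact fam_homS x : fam_hom_fun x^† = (fam_hom_fun x)^†.
Proof. by apply: fam_ext => i /=; rewrite homS. Qed.

Definition fam_hom : starHom A fam := StarHom fam_hom_linear fam_homM fam_homS.

End FamilyHom.

Section Evaluation.
Variable i : I.
Definition fam_ev_fun (f : fam) : B i := f i.
Fact fam_ev_linear : linear fam_ev_fun. Proof. by []. Qed.
Fact fam_evM x y : fam_ev_fun (x ∙ y) = fam_ev_fun x ∙ fam_ev_fun y.
Proof. by []. Qed.
Fact fam_evS x : fam_ev_fun x^† = (fam_ev_fun x)^†. Proof. by []. Qed.
Definition fam_ev : starHom fam (B i) := StarHom fam_ev_linear fam_evM fam_evS.
End Evaluation.

End Families.

(** * Ideals, and maps that are *-homomorphisms modulo an ideal *)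

Section Ideals.
Variable R : realType.

Section Ideal.
Variables (B : cstarAlgType R).
Implicit Types (x y : B) (K : ideal B).

Definition zero_ideal : ideal B.
Proof.
exists [set 0].
- by [].
- by move=> x y -> ->; rewrite /= addr0.
- by move=> k x ->; rewrite /= scaler0.
- by move=> x y ->; rewrite /= cmul0r.
- by move=> x y ->; rewrite /= cmul0l.
- apply: nrm_closed_closed => x x0; apply: (@nrm_small _ _ _ 1) => e.
  by move=> /x0[y -> ]; rewrite subr0 mul1r => /ltW.
Defined.

Definition full_ideal : ideal B.
Proof. by exists setT => //; exact: closedT. Defined.

Definition idealI (K L : ideal B) : ideal B.
Proof.
exists (ideal_set K `&` ideal_set L).
- by split; exact: ideal0.
- by move=> x y [Kx Lx] [Ky Ly]; split; exact: idealD.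
- by move=> k x [Kx Lx]; split; exact: idealZ.
- by move=> x y [Ky Ly]; split; exact: Defs.idealMl.
- by move=> x y [Kx Lx]; split; exact: Defs.idealMr.
- by apply: closedI; exact: ideal_closed.
Defined.

End Ideal.

Section HomModulo.
Variables (A C : cstarAlgType R).
Implicit Types (f g : A -> C) (K : set C).

(** These are the defects that must vanish for [f] to induce a *-homomorphism into a quotient. [K]
    is a bare set, so that the condition can be combined over intersections. *)
Definition hom_mod K f :=
  [/\ forall k x y, K (f (k *: x + y) - (k *: f x + f y)),
      forall x y, K (f (x ∙ y) - f x ∙ f y) &
      forall x, K (f x^† - (f x)^†)].

Lemma hom_modI K L f : hom_mod K f -> hom_mod L f -> hom_mod (K `&` L) f.
Proof. by move=> [? ? ?] [? ? ?]; split. Qed.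

(** This allows lifts to be chosen one element at a time: their defects die in the quotient, where
    [r] has none. *)
Lemma hom_mod_quot (K : ideal C) f (r : starHom A (quot K)) :
  (forall a, quot_pi K (f a) = r a) -> hom_mod (ideal_set K) f.
Proof.
move=> fr; split=> [k x y|x y|x]; apply/quot_piP.
- by rewrite quot_piD quot_piZ !fr hom_linear.
- by rewrite quot_piM !fr homM.
- by rewrite quot_piS !fr homS.
Qed.

Lemma hom_mod_congr (K : ideal C) f (phi : starHom A C) :
  (forall a, ideal_set K (f a - phi a)) -> hom_mod (ideal_set K) f.
Proof.
move=> fphi; apply: (@hom_mod_quot K f (hom_comp (quot_hom K) phi)) => a.
exact/quot_piP.
Qed.

Section QuotientHom.
Variables (K : ideal C) (f : A -> C).
Hypothesis Kf : hom_mod (ideal_set K) f.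

Definition hom_of_mod_fun (a : A) : quot K := quot_pi K (f a).

Fact hom_of_mod_linear : linear hom_of_mod_fun.
Proof.
move=> k x y; rewrite /hom_of_mod_fun -[k *: quot_pi K _]quot_piZ -quot_piD.
by apply/quot_piP; case: Kf.
Qed.

Fact hom_of_modM x y :
  hom_of_mod_fun (x ∙ y) = hom_of_mod_fun x ∙ hom_of_mod_fun y.
Proof.
by rewrite /hom_of_mod_fun -[RHS]quot_piM; apply/quot_piP; case: Kf.
Qed.

Fact hom_of_modS x : hom_of_mod_fun x^† = (hom_of_mod_fun x)^†.
Proof.
by rewrite /hom_of_mod_fun -[RHS]quot_piS; apply/quot_piP; case: Kf.
Qed.

Definition hom_of_mod : starHom A (quot K) :=
  StarHom hom_of_mod_linear hom_of_modM hom_of_modS.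

Lemma is_lift_mod (chi : starHom A C) :
  is_lift chi hom_of_mod -> forall a, ideal_set K (chi a - f a).
Proof.
move=> chif a; apply/quot_piP.
by have /esym := congr1 (fun h : starHom A (quot K) => h a) chif.
Qed.

Lemma hom_of_mod_close (chi : starHom A C) a (M : R) :
  nrm (chi a - f a) <= M ->
  nrm (hom_comp (quot_hom K) chi a - hom_of_mod a) <= M.
Proof.
move=> le; apply: le_trans le; rewrite -[X in nrm X]quot_piB qnrmE.
exact: qnrm_le.
Qed.

End QuotientHom.
End HomModulo.

Lemma is_liftP (A B : cstarAlgType R) (J : ideal B) (chi : starHom A B)
    (phi : starHom A (quot J)) :
  is_lift chi phi <-> forall a, quot_pi J (chi a) = phi a.
Proof.
split=> [-> //|chiphi]; apply: hom_ext => a; exact/esym/chiphi.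
Qed.

Section PointwiseIdeals.
Variables (I : Type) (B : I -> cstarAlgType R) (S : family_algebra B).
Implicit Types f : fam S.

Definition pointwise_ideal (K : forall i, ideal (B i)) : ideal (fam S).
Proof.
exists [set f : fam S | forall i, ideal_set (K i) (f i)].
- by move=> i; exact: ideal0.
- by move=> f g Kf Kg i; exact: idealD (Kf i) (Kg i).
- by move=> k f Kf i; exact: idealZ k _ (Kf i).
- by move=> f g Kg i; exact: Defs.idealMl (Kg i).
- by move=> f g Kf i; exact: Defs.idealMr (Kf i).
- apply: nrm_closed_closed => f Kf i.
  apply: (closed_nrm (@ideal_closed _ _ (K i))) => e /Kf[g Kg fg].
  exists (g i) => //; apply: le_lt_trans fg.
  by rewrite fnrmE -famBE nrm_fam_le.
Defined.

Lemma hom_mod_pointwise (A : cstarAlgType R) (K : forall i, ideal (B i))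
    (f : A -> fam S) :
  (forall i, hom_mod (ideal_set (K i)) (fun a => f a i)) ->
  hom_mod (ideal_set (pointwise_ideal K)) f.
Proof.
move=> Kf; split.
- by move=> k x y i; have [+ _ _] := Kf i; apply.
- by move=> x y i; have [_ + _] := Kf i; apply.
- by move=> x i; have [_ _ +] := Kf i; apply.
Qed.

(** For bounded sequences and the cofinite filter this is the [c_0]-sum inside the product. *)
Definition vanishing_ideal (F : set_system I) (FF : Filter F) : ideal (fam S).
Proof.
exists [set f : fam S | forall e : R, 0 < e -> F [set i | nrm (f i) < e]].
- by move=> e e0; apply: filterE => i /=; rewrite nrm0.
- move=> f g Ff Fg e e0; have e2 : 0 < e / 2 by rewrite divr_gt0.
  apply: filterS2 (Ff _ e2) (Fg _ e2) => i /= fi gi.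
  by rewrite (le_lt_trans (nrmD _ _))// (splitr e) ltrD.
- move=> k f Ff e e0; have k0 : 0 < complex.Re `|k| + 1.
    by rewrite ltr_wpDl// -lecR RRe_real// normr_ge0.
  apply: filterS (Ff (e / (complex.Re `|k| + 1)) (divr_gt0 e0 k0)) => i /=.
  rewrite ltr_pdivlMr// => fe; rewrite nrmZ; apply: le_lt_trans fe.
  by rewrite mulrC ler_wpM2l ?nrm_ge0// lerDl.
- move=> f g Fg e e0.
  have f0 : 0 < fnrm f + 1 by rewrite ltr_wpDl// fnrm_ge0.
  apply: filterS (Fg (e / (fnrm f + 1)) (divr_gt0 e0 f0)) => i /=.
  rewrite ltr_pdivlMr// => ge; rewrite (le_lt_trans (nrmM _ _))//.
  apply: le_lt_trans ge; rewrite mulrC ler_wpM2l ?nrm_ge0//.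
  by rewrite (le_trans (nrm_fam_le f i))// lerDl.
- move=> g f Fg e e0.
  have f0 : 0 < fnrm f + 1 by rewrite ltr_wpDl// fnrm_ge0.
  apply: filterS (Fg (e / (fnrm f + 1)) (divr_gt0 e0 f0)) => i /=.
  rewrite ltr_pdivlMr// => ge; rewrite (le_lt_trans (nrmM _ _))//.
  apply: le_lt_trans ge; rewrite ler_wpM2l ?nrm_ge0//.
  by rewrite (le_trans (nrm_fam_le f i))// lerDl.
- apply: nrm_closed_closed => f Ff e e0.
  have e2 : 0 < e / 2 by rewrite divr_gt0.
  have [g /(_ _ e2) Fg fg] := Ff _ e2.
  apply: filterS Fg => i /= gi; rewrite -[f i](subrK (g i)).
  rewrite (le_lt_trans (nrmD _ _))// (splitr e) ltrD//.
  by rewrite (le_lt_trans _ fg)// (nrm_fam_le (f - g) i).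
Defined.

End PointwiseIdeals.
End Ideals.

(** * Uniform openness *)

Section UniformlyOpen.
Variable R : realType.

Section BoundedFamilies.
Variables (I : Type) (B : I -> cstarAlgType R).

Definition bounded_families : family_algebra B.
Proof.
exists (fun f => exists M, forall i, nrm (f i) <= M).
- by [].
- by exists 0 => i; rewrite nrm0.
- move=> f g [M fM] [N gN]; exists (M + N) => i.
  by rewrite (le_trans (nrmD _ _))// lerD.
- move=> k f [M fM]; exists (complex.Re `|k| * M) => i.
  by rewrite nrmZ ler_wpM2l// -lecR RRe_real// normr_ge0.
- move=> f g [M fM] [N gN]; exists (M * N) => i.
  by rewrite (le_trans (nrmM _ _))// ler_pM ?nrm_ge0.
- by move=> f [M fM]; exists M => i; rewrite nrm_cstar.
- move=> f /(_ 1 ltr01)[g [M gM] fg]; exists (1 + M) => i.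
  by rewrite -[f i](subrK (g i)) (le_trans (nrmD _ _))// lerD.
Defined.

End BoundedFamilies.

Definition later (A : choiceType) (i j : nat * {fset A}) :=
  (i.1 <= j.1)%N /\ {subset i.2 <= j.2}.

(** Nets replace sequences here because the finite subsets of an uncountable [A] have no countable
    cofinal family. *)
Definition tails (A : choiceType) : set_system (nat * {fset A}) :=
  filter_from setT (fun i => [set j | later i j]).

Lemma tails_filter (A : choiceType) : ProperFilter (@tails A).
Proof.
apply: filter_from_proper; last by move=> i _; exists i; split.
apply: filter_from_filter; first by exists (0%N, fset0).
move=> i j _ _; exists (maxn i.1 j.1, i.2 `|` j.2)%fset => // k [/= ijk sub].
move: ijk; rewrite geq_max => /andP[ik jk]; split; split=> //= x xi.
  by apply: sub; rewrite inE xi.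
by apply: sub; rewrite inE xi orbT.
Qed.

Lemma tails_later (A : choiceType) (i : nat * {fset A}) :
  tails [set j | later i j].
Proof. by exists i. Qed.

Definition tol (n : nat) : R := n.+1%:R^-1.

Lemma tol_gt0 n : 0 < tol n. Proof. by rewrite invr_gt0. Qed.

Lemma tol_le m n : (m <= n)%N -> tol n <= tol m.
Proof. by move=> mn; rewrite lef_pV2 ?posrE// ler_nat ltnS. Qed.

Lemma tol_lt (e : R) : 0 < e -> exists n, tol n < e.
Proof.
move=> e0; exists (Num.trunc e^-1).
by rewrite invf_plt ?posrE//; exact: truncnS_gt.
Qed.

Record failure (A : cstarAlgType R) (eps : R) (F : {fset A})
    (i : nat * {fset A}) := Failure {
  fail_B : cstarAlgType R;
  fail_J : ideal fail_B;
  fail_gamma : starHom A (quot fail_J);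
  fail_phi : starHom A (quot fail_J);
  fail_lift : starHom A fail_B;
  fail_close : forall u, u \in i.2 ->
    nrm (fail_phi u - fail_gamma u) <= tol i.1;
  fail_is_lift : is_lift fail_lift fail_gamma;
  fail_far : forall chi, is_lift chi fail_phi ->
    exists2 v, v \in F & eps <= nrm (chi v - fail_lift v)
}.

(** A failure is data, whereas the argument by contradiction only proves propositions. The
    conclusion therefore asserts inhabitation, from which [cid] later picks one failure for each
    index. *)
Lemma not_uniform_failure (A : cstarAlgType R) (eps : R) (F : {fset A}) :
  (forall (delta : R) (G : {fset A}), 0 < delta -> ~
    forall (B : cstarAlgType R) (J : ideal B) (gamma phi : starHom A (quot J))
           (gammabar : starHom A B),
      (forall u, u \in G -> `|gamma u - phi u| < delta%:C) ->
      is_lift gammabar gamma ->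
      exists phibar : starHom A B, is_lift phibar phi /\
        forall v, v \in F -> `|gammabar v - phibar v| < eps%:C) ->
  forall i, exists _ : failure eps F i, True.
Proof.
move=> nunif i; apply: contrapT => nofail.
apply: (nunif (tol i.1) i.2); first exact: tol_gt0.
move=> B J gamma phi gammabar close lift.
apply: contrapT => nophi; apply: nofail.
unshelve eexists; last by [].
apply: (@Failure A eps F i B J gamma phi gammabar) => //.
  by move=> u /close; rewrite nrmE ltcR nrmBC => /ltW.
move=> chi lchi; apply: contrapT => near; apply: nophi; exists chi; split=> //.
move=> v vF; rewrite nrmE ltcR nrmBC ltNge; apply/negP => far.
by apply: near; exists v.
Qed.

Section FailureFamily.
Variables (A : cstarAlgType R) (eps : R) (F : {fset A}).
Hypothesis eps0 : 0 < eps.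
Hypothesis lo : l_open A.
Variable fl : forall i, failure eps F i.

Let S := bounded_families (fun i => fail_B (fl i)).

(** The quotient norm is an infimum, so a representative of the difference may exceed it a little.
    The allowance [tol i.1] tends to 0 along [tails]. *)
Lemma fail_correction i (a : A) : exists d : fail_B (fl i),
  quot_pi (fail_J (fl i)) (fail_lift (fl i) a + d) = fail_phi (fl i) a /\
  nrm d <= nrm (fail_phi (fl i) a - fail_gamma (fl i) a) + tol i.1.
Proof.
have n0 := tol_gt0 i.1.
have [d dE dn] := qnrm_lift (fail_phi (fl i) a - fail_gamma (fl i) a) n0.
exists d; split; last by rewrite qnrmE ltW.
have /is_liftP lift := fail_is_lift (fl i).
by rewrite quot_piD lift dE addrC subrK.
Qed.

Lemma no_failure_family : False.
Proof.
have FF := tails_filter A.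
pose d i a := sval (cid (fail_correction i a)).
have dP i a : quot_pi (fail_J (fl i)) (fail_lift (fl i) a + d i a) =
      fail_phi (fl i) a /\
    nrm (d i a) <= nrm (fail_phi (fl i) a - fail_gamma (fl i) a)
      + tol i.1 by exact: svalP (cid (fail_correction i a)).
have liftB a : S (fun i => fail_lift (fl i) a).
  by exists (nrm a) => i; exact: starHom_nrm_le.
pose gam := fam_hom liftB.
(* From [k] on, the lift of [fail_gamma] is corrected to a lift of [fail_phi]. Corrections are
   chosen element by element, so [c k] need not give a *-homomorphism before passing to a
   quotient. *)
pose c k i a := if `[< later k i >] then fail_lift (fl i) a + d i a
  else fail_lift (fl i) a.
have cB k a : S (fun i => c k i a).
  exists (nrm a + (nrm a + nrm a + 1)) => i; rewrite /c; case: ifP => _.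
    apply: le_trans (nrmD _ _) _; apply: lerD; first exact: starHom_nrm_le.
    apply: le_trans (dP i a).2 _; apply: lerD.
      by apply: le_trans (nrmB _ _) _; apply: lerD; exact: starHom_nrm_le.
    by apply: (le_trans (tol_le (leq0n _))); rewrite /tol invr1.
  by apply: le_trans (starHom_nrm_le _ _) _; rewrite lerDl !addr_ge0 ?nrm_ge0.
pose f k a : fam S := Fam (cB k a).
pose J := pointwise_ideal S (fun i => fail_J (fl i)).
pose N := vanishing_ideal S FF.
have dsmall e a : 0 < e -> exists k, forall i, later k i -> nrm (d i a) <= e.
  move=> e0; have e2 : 0 < e / 2 by rewrite divr_gt0.
  have [n ne] := tol_lt e2; exists (n, [fset a]%fset) => i [/= ni ai].
  have ia : a \in i.2 by apply: ai; rewrite inE.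
  have := (dP i a).2; have := fail_close (fl i) ia.
  have := tol_le ni.
  lra.
have fJ k : hom_mod (ideal_set J) (f k).
  apply: hom_mod_pointwise => i /=; rewrite /c; case: `[< later k i >].
    by apply: (hom_mod_quot (r := fail_phi (fl i))) => a; exact: (dP i a).1.
  apply: (hom_mod_quot (r := fail_gamma (fl i))) => a.
  by have /is_liftP := fail_is_lift (fl i).
have fN k a : ideal_set N (f k a - gam a).
  move=> e e0; have e2 : 0 < e / 2 by rewrite divr_gt0.
  have [k' dk'] := dsmall _ a e2.
  apply: filterS (tails_later k') => i /dk' de; rewrite /mkset famBE /= /c.
  case: ifP => _; last by rewrite subrr nrm0.
  rewrite addrAC subrr add0r; lra.
(* Modulo [N] the map [f k] is [gam], as the corrections tend to 0; modulo [J] it is composed of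
   [fail_phi] and [fail_gamma]. Dividing by the intersection retains both facts. *)
have fNJ k := hom_modI (hom_mod_congr (fN k)) (fJ k).
have : nbhs (hom_comp (quot_hom (idealI N J)) gam)
    (@liftable R A (fam S) (idealI N J)).
  by apply: open_nbhs_nbhs; split; [exact: lo|exists gam].
move=> [G [e [e0 Ge]]].
have e3 : 0 < e / 3 by rewrite divr_gt0.
have [n ne] := tol_lt e3; pose k := (n, G).
have [chi chil] : liftable (hom_of_mod (K := idealI N J) (fNJ k)).
  apply: Ge => a aG; rewrite nrmE ltcR nrmBC.
  (* One [tol n] bounds the distance from [fail_phi] to [fail_gamma] on [G], the other the excess
     norm of the correction. *)
  apply: (@le_lt_trans _ _ (2 * tol n)); last by lra.
  apply: hom_of_mod_close; rewrite fnrmE.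
  apply: fnrm_le => [|i]; first by rewrite mulr_ge0 ?ltW ?tol_gt0.
  rewrite famBE /= /c; case: ifPn => [/asboolP[/= ni Gi]|_]; last first.
    by rewrite subrr nrm0 mulr_ge0// ltW ?tol_gt0.
  rewrite opprD addrA subrr add0r nrmN.
  have := (dP i a).2; have := fail_close (fl i) (Gi _ aG).
  have := tol_le ni.
  lra.
have chif a := is_lift_mod chil a.
have near v : tails [set i | nrm (chi v i - gam v i) < eps].
  have /(_ _ eps0) : ideal_set N (chi v - gam v).
    rewrite -(subrKA (f k v)); apply: idealD; last exact: fN.
    by have [] := chif v.
  by [].
(* As [F] is finite, some index later than [k] has [chi] close to [gam] on all of [F]. There the
   coordinate of [chi] lifts [fail_phi], against [fail_far]. *)
have [i [ki iF]] : [set i | later k i] `&`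
    [set i | forall v, v \in F -> nrm (chi v i - gam v i) < eps] !=set0.
  apply: (@filter_ex _ (@tails A) FF).
  apply: filterI; first exact: tails_later.
  have := @filter_bigI _ A F (fun v => [set i | nrm (chi v i - gam v i) < eps])
    (@tails A) FF (fun v _ => near v).
  by apply: filterS => i iF v vF; exact: iF.
have [|v vF] := @fail_far _ _ _ _ (fl i) (hom_comp (fam_ev S i) chi).
  apply/is_liftP => a; have [_ /(_ i)/quot_piP] := chif a.
  rewrite /= /c asboolT// => E; rewrite -(dP i a).1 -E//.
by have := iF _ vF; rewrite /= => /lt_geF ->.
Qed.

End FailureFamily.

Lemma l_open_uniformly_open (A : cstarAlgType R) : l_open A -> uniformly_open A.
Proof.
move=> lo eps F e0; apply: contrapT => nunif.
have fl : forall i, exists _ : failure eps F i, True.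
  apply: not_uniform_failure => delta G d0 H; apply: nunif.
  by exists delta, G.
exact: (no_failure_family e0 lo (fun i => sval (cid (fl i)))).
Qed.

End UniformlyOpen.

(** * Continuous paths *)

Section NormContinuity.
Variable R : realType.

(** For [a <= b], the retraction of the line onto [[a, b]]. Composing with it extends a path on an
    interval to the whole line, so that subspace topologies can be avoided. *)
Definition clamp (a b t : R) : R := Num.max a (Num.min b t).

Lemma clamp_itv (a b t : R) : a <= b -> a <= clamp a b t <= b.
Proof. by move=> ab; rewrite /clamp le_max lexx/= ge_max ab ge_min lexx. Qed.

Lemma clamp_id (a b t : R) : a <= t <= b -> clamp a b t = t.
Proof. by move=> /andP[at_ tb]; rewrite /clamp (min_idPr tb) (max_idPr at_). Qed.

Lemma clamp_le (a b t : R) : a <= b -> t <= a -> clamp a b t = a.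
Proof.
by move=> ab ta; rewrite /clamp (min_idPr (le_trans ta ab)) (max_idPl ta).
Qed.

Lemma clamp_ge (a b t : R) : a <= b -> b <= t -> clamp a b t = b.
Proof. by move=> ab bt; rewrite /clamp (min_idPl bt) (max_idPr ab). Qed.

Lemma min_continuous (a : R) : continuous (Num.min a).
Proof.
by move=> t; apply: (@continuous_min _ _ (fun=> a) id); [exact: cvg_cst|].
Qed.

Lemma clamp_continuous (a b : R) : continuous (clamp a b).
Proof.
move=> t; apply: (@continuous_max _ _ (fun=> a) (Num.min b)).
  exact: cvg_cst.
exact: min_continuous.
Qed.

Lemma nearP_dist (t : R) (P : R -> Prop) :
  (\forall s \near t, P s) <->
  exists2 h, 0 < h & forall s, `|t - s| < h -> P s.
Proof.
split=> [/nbhs_ballP[h /= h0 hP]|[h h0 hP]].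
  by exists h => // s ts; apply: hP; rewrite -ball_normE.
by apply/nbhs_ballP; exists h => // s; rewrite -ball_normE => /hP.
Qed.

(** Let [c] be the supremum of the points satisfying [P]. Some such point lies within [h] of [c],
    and the step from there leads beyond [c] unless [b] is reached first. *)
Lemma continuous_induction (P : R -> Prop) (a b : R) : a <= b -> P a ->
  (forall x, a <= x <= b -> exists2 h, 0 < h & forall s t,
     a <= s -> s <= t -> t <= b -> `|x - s| < h -> `|x - t| < h ->
     P s -> P t) ->
  P b.
Proof.
move=> ab Pa step; pose E := [set s | a <= s <= b /\ P s].
have Ea : E a by split=> //; rewrite lexx.
have ubE : ubound E b by move=> s [/andP[]].
have sE : has_sup E by split; [exists a|exists b].
have cle : sup E <= b by apply: ge_sup => //; exists a.
have cge : a <= sup E by apply: ub_le_sup => //; exists b.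
have [|h h0 hP] := step (sup E); first by rewrite cge.
have [s [/andP[as_ sb] Ps] sc] := sup_adherent h0 sE.
have sle : s <= sup E by apply: ub_le_sup; [exists b|split=> //; rewrite as_].
have h2 : 0 < h / 2 by rewrite divr_gt0.
have dist : forall t, s <= t -> t <= sup E + h / 2 -> `|sup E - t| < h.
  by move=> t st tE; rewrite ltr_norml; apply/andP; split; lra.
have Pt t : s <= t -> t <= b -> t <= sup E + h / 2 -> P t.
  move=> st tb tE; apply: (hP s) => //; apply: dist => //; lra.
have [bE|Eb] := leP b (sup E + h / 2); first by apply: Pt.
have : E (sup E + h / 2) by split; [apply/andP; split; lra|apply: Pt; lra].
by move=> /(ub_le_sup (ex_intro _ b ubE)); lra.
Qed.

Section NormedModules.
Variable V : normedModType R[i].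
Implicit Types f g : R -> V.

Definition ncont f :=
  forall t (e : R), 0 < e -> \forall s \near t, nrm (f s - f t) < e.

(** Estimates may thus carry a factor [K] that depends on the point [t]; the bound is used at
    [e / (2 * K)] to get a strict inequality. *)
Lemma ncont_near f t : (exists2 K : R, 0 < K &
    forall e, 0 < e -> \forall s \near t, nrm (f s - f t) <= K * e) ->
  forall e : R, 0 < e -> \forall s \near t, nrm (f s - f t) < e.
Proof.
move=> [K K0 Kf] e e0; have K2 : 0 < K * 2 by rewrite mulr_gt0.
apply: filterS (Kf (e / (K * 2)) (divr_gt0 e0 K2)) => s.
move=> /le_lt_trans; apply.
have -> : K * (e / (K * 2)) = e / 2 by field; rewrite ?gt_eqF.
by rewrite ltr_pdivrMr// ltr_pMr// ltr1n.
Qed.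

Lemma ncont_cst v : ncont (fun=> v).
Proof. by move=> t e e0; apply: filterE => s; rewrite subrr nrm0. Qed.

Lemma ncontD f g : ncont f -> ncont g -> ncont (fun t => f t + g t).
Proof.
move=> cf cg t; apply: ncont_near; exists 2 => // e e0.
apply: filterS2 (cf t e e0) (cg t e e0) => s fs gs.
rewrite opprD addrACA (le_trans (nrmD _ _))// mulr_natl mulr2n.
by rewrite lerD// ltW.
Qed.

Lemma ncontN f : ncont f -> ncont (fun t => - f t).
Proof.
by move=> cf t e e0; apply: filterS (cf t e e0) => s; rewrite -opprD nrmN.
Qed.

Lemma ncontB f g : ncont f -> ncont g -> ncont (fun t => f t - g t).
Proof. by move=> cf cg; apply: ncontD => //; exact: ncontN. Qed.

Lemma ncont_scale f (k : R[i]) : ncont f -> ncont (fun t => k *: f t).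
Proof.
move=> cf t; apply: ncont_near.
have k0 : 0 <= complex.Re `|k| by rewrite -lecR RRe_real// normr_ge0.
exists (complex.Re `|k| + 1) => [|e e0]; first by rewrite ltr_wpDl.
apply: filterS (cf t e e0) => s fs; rewrite -scalerBr nrmZ.
by rewrite ler_pM ?nrm_ge0 ?(ltW fs)// lerDl.
Qed.

Lemma ncontZ f (c : R -> R) : continuous c -> ncont f ->
  ncont (fun t => (c t)%:C *: f t).
Proof.
move=> cc cf t; apply: ncont_near.
exists (`|c t| + 1 + nrm (f t)) => [|e e0].
  by rewrite ltr_wpDr ?nrm_ge0// ltr_wpDl.
have /cvgrPdist_lt ct := cc t.
have near1 : \forall s \near t, `|c s| <= `|c t| + 1.
  apply: filterS (ct 1 ltr01) => s cs.
  by rewrite -(subrK (c t) (c s)) addrC (le_trans (ler_normD _ _))//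
    lerD2l distrC ltW.
apply: filterS3 near1 (ct e e0) (cf t e e0) => s c1 cs fs.
have -> : (c s)%:C *: f s - (c t)%:C *: f t =
    (c s)%:C *: (f s - f t) + (c s - c t)%:C *: f t.
  by rewrite scalerBr rmorphB scalerBl addrA subrK.
rewrite (le_trans (nrmD _ _))// !nrmZR mulrDl lerD//.
  by rewrite ler_pM ?nrm_ge0 ?(ltW fs).
by rewrite mulrC ler_wpM2l ?nrm_ge0// distrC ltW.
Qed.

Lemma ncont_comp f (c : R -> R) : continuous c -> ncont f ->
  ncont (fun t => f (c t)).
Proof. by move=> cc cf t e e0; exact: cc _ _ (cf (c t) e e0). Qed.

Lemma ncont_closed f :
  (forall e : R, 0 < e -> exists2 g, ncont g & forall i, nrm (f i - g i) <= e) ->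
  ncont f.
Proof.
move=> fg t; apply: ncont_near; exists 3 => // e e0; have [g cg gf] := fg e e0.
apply: filterS (cg t e e0) => s gs.
have := nrm_triangle (g s) (f s) (f t); have := nrm_triangle (g t) (g s) (f t).
by have := gf s; have := gf t; rewrite (nrmBC (f t)); lra.
Qed.

Lemma nrm_convex (c : R) (x y : V) (M : R) : 0 <= c <= 1 ->
  nrm x <= M -> nrm y <= M -> nrm (x + c%:C *: (y - x)) <= M.
Proof.
move=> /andP[c0 c1] xM yM.
have -> : x + c%:C *: (y - x) = (1 - c)%:C *: x + c%:C *: y.
  by rewrite rmorphB/= scalerBl scale1r scalerBr addrA addrAC.
rewrite (le_trans (nrmD _ _))// !nrmZR !ger0_norm ?subr_ge0//.
have := ler_wpM2l c0 yM; have := ler_wpM2l (_ : 0 <= 1 - c) xM.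
by rewrite subr_ge0 => /(_ c1); lra.
Qed.

End NormedModules.

Lemma ncontM (B : cstarAlgType R) (f g : R -> B) : ncont f -> ncont g ->
  ncont (fun t => f t ∙ g t).
Proof.
move=> cf cg t; apply: ncont_near.
exists (nrm (f t) + 1 + nrm (g t)) => [|e e0].
  by rewrite ltr_wpDr ?nrm_ge0// ltr_wpDl ?nrm_ge0.
apply: filterS3 (cf t 1 ltr01) (cf t e e0) (cg t e e0) => s f1 fs gs.
have -> : f s ∙ g s - f t ∙ g t = f s ∙ (g s - g t) + (f s - f t) ∙ g t.
  by rewrite cmulBr cmulBl addrA subrK.
rewrite (le_trans (nrmD _ _))// mulrDl lerD// (le_trans (nrmM _ _))//.
  rewrite ler_pM ?nrm_ge0 ?(ltW gs)// -(subrK (f t) (f s)) addrC.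
  by rewrite (le_trans (nrmD _ _))// lerD2l ltW.
by rewrite mulrC ler_wpM2l ?nrm_ge0// ltW.
Qed.

Lemma ncont_star (B : cstarAlgType R) (f : R -> B) : ncont f ->
  ncont (fun t => (f t)^†).
Proof.
by move=> cf t e e0; apply: filterS (cf t e e0) => s; rewrite -cstarB nrm_cstar.
Qed.

Lemma ncont_hom (B C : cstarAlgType R) (h : starHom B C) (f : R -> B) :
  ncont f -> ncont (fun t => h (f t)).
Proof.
move=> cf t e e0; apply: filterS (cf t e e0) => s; rewrite -linearB.
exact/le_lt_trans/starHom_nrm_le.
Qed.

Section PointNormContinuity.
Variables A B : cstarAlgType R.

Lemma continuous_hom_ncont (g : R -> starHom A B) :
  continuous g <-> forall a, ncont (fun t => g t a).
Proof.
split=> [cg a t e e0|cg t U [F [e [e0 FU]]]].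
  have : nbhs (g t) (hom_ball (g t) [fset a]%fset e).
    by exists [fset a]%fset, e; split.
  move=> gU; have : nbhs t (g @^-1` hom_ball (g t) [fset a]%fset e).
    exact: cg t _ gU.
  apply: filterS => s /= /(_ a); rewrite inE eqxx => /(_ isT).
  by rewrite nrmE ltcR.
have gF := @filter_bigI _ A F (fun a => [set s | nrm (g s a - g t a) < e])
  (nbhs t) (nbhs_filter t) (fun a _ => cg a t e e0).
suff : nbhs t (g @^-1` U) by [].
apply: filterS gF => s sF; apply: FU => a aF; rewrite nrmE ltcR.
exact: (sF a aF).
Qed.

Lemma within_ncont (g : R -> starHom A B) :
  {within `[0, 1], continuous g} ->
  forall a, ncont (fun t => g (clamp 0 1 t) a).
Proof.
move=> /subspace_continuousP cg.
apply/(continuous_hom_ncont (fun t => g (clamp 0 1 t))) => t U.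
have c01 s : `[0%R, 1%R]%classic (clamp 0 1 s).
  by rewrite /= in_itv/= clamp_itv.
move=> gU; have gV := cg _ (c01 t) _ gU.
have gW : nbhs t [set s | `[0%R, 1%R]%classic (clamp 0 1 s) ->
    U (g (clamp 0 1 s))] by exact: (@clamp_continuous 0 1 t _ gV).
suff : nbhs t ((fun s => g (clamp 0 1 s)) @^-1` U) by [].
by apply: filterS gW => s /=; apply; exact: c01.
Qed.

Lemma ncont_within (g : R -> starHom A B) :
  (forall a, ncont (fun t => g t a)) -> {within `[0, 1], continuous g}.
Proof. by move=> cg; apply/continuous_subspaceT/continuous_hom_ncont. Qed.

End PointNormContinuity.

Definition path_algebra (B : cstarAlgType R) : family_algebra (fun _ : R => B).
Proof.
exists (fun f => bounded_families (fun=> B) f /\ ncont f).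
- by move=> f [].
- by split; [exact: family0|exact: ncont_cst].
- by move=> f g [bf cf] [bg cg]; split; [exact: familyD|exact: ncontD].
- by move=> k f [bf cf]; split; [exact: familyZ|exact: ncont_scale].
- by move=> f g [bf cf] [bg cg]; split; [exact: familyM|exact: ncontM].
- by move=> f [bf cf]; split; [exact: familyS|exact: ncont_star].
- move=> f fg; split.
    by apply: family_closed => e /fg[g []]; exists g.
  by apply: ncont_closed => e /fg[g []]; exists g.
Defined.

End NormContinuity.
Notation paths B := (fam (path_algebra B)).

(** * Lifting paths and homotopies *)

Section Lifting.
Variable R : realType.

(* The error left by one approximate preimage is corrected by the next; the
   resulting series converges geometrically. *)
Lemma exact_of_approximate (V : completeNormedModType R[i])
    (W : normedModType R[i]) (T : {additive V -> W}) (P : set V) (D : set W) :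
  (forall v, nrm (T v) <= nrm v) -> nrm_closed P ->
  (forall u v, P u -> P v -> P (u + v)) ->
  (forall w (M e : R), D w -> nrm w <= M -> 0 < e ->
     exists v, [/\ P v, nrm v <= M + e, D (w - T v) & nrm (w - T v) <= e]) ->
  forall w (M e : R), D w -> nrm w <= M -> 0 < e ->
    exists v, [/\ P v, nrm v <= M + e & T v = w].
Proof.
move=> T1 cP PD approx w M e Dw wM e0.
(* The first approximation costs [d], and the corrections, at most [2 * c n] each, add up to
   [4 * d]. The total [5 * d] stays below [e]. *)
pose d := e / 8; pose c (n : nat) : R := d * 2^-1 ^+ n.
have d0 : 0 < d by rewrite divr_gt0.
have c0 n : 0 < c n by rewrite mulr_gt0// exprn_gt0// invr_gt0.
have cS n : c n.+1 = c n / 2 by rewrite /c exprS mulrCA mulrC.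
pose good n v := [/\ P v, D (w - T v) & nrm (w - T v) <= c n].
have /choice[next nextP] (nv : nat * V) : exists v', good nv.1 nv.2 ->
    good nv.1.+1 v' /\ nrm (v' - nv.2) <= 2 * c nv.1.
  case: nv => n v /=; have [[Pv Dv vn]|ng] := pselect (good n v); last first.
    (* The value 0 is a dummy: the sequence [u] only passes through good stages. *)
    by exists 0 => /ng.
  have [x [Px xn Dx wx]] := approx _ _ _ Dv vn (c0 n.+1).
  exists (v + x) => _; rewrite /good raddfD/= opprD addrA; split.
    by split=> //; exact: PD.
  rewrite addrAC subrr add0r (le_trans xn)// cS.
  by have := c0 n; lra.
have [v0 [Pv0 v0n Dv0 wv0]] := approx _ _ _ Dw wM d0.
pose u := fix u n := if n is m.+1 then next (m, u m) else v0.
have ug n : good n (u n).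
  elim: n => [|n IH]; first by split; rewrite // /c expr0 mulr1.
  by have [] := nextP (n, u n) IH.
have uS n : nrm (u n.+1 - u n) <= 2 * d * 2^-1 ^+ n.
  by rewrite -mulrA; have [] := nextP (n, u n) (ug n).
have half : 0 <= (2^-1 : R) < 1 by apply/andP; split; lra.
have [|l lu] := fast_cauchy _ half uS; first by rewrite mulr_ge0// ltW.
have {}lu n : nrm (l - u n) <= 4 * c n.
  by apply: le_trans (lu n) _; rewrite /c le_eqVlt; apply/orP; left;
    apply/eqP; field.
exists l; split.
- apply: cP => r r0; have [n nr] := expr_small (4 * d) half r0.
  by exists (u n); [case: (ug n)|rewrite (le_lt_trans (lu n))// /c mulrA].
- have := nrmD (l - u 0%N) (u 0%N); rewrite subrK /=.
  by have := lu 0%N; rewrite /c expr0 mulr1 /= /d in v0n *; lra.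
- apply/eqP; rewrite -subr_eq0; apply/eqP.
  (* The factor is 4 for the distance from [l] to [u n], plus 1 for the error left at stage [n]. *)
  apply: (@nrm_small _ _ _ 5) => r r0; have [n nr] := expr_small d half r0.
  have [_ _ wu] := ug n.
  have := nrm_triangle (T (u n)) (T l) w; rewrite -raddfB.
  have := T1 (l - u n); have := lu n; rewrite (nrmBC (T (u n))).
  by rewrite -/(c n) in nr; lra.
Qed.

Section PathLifting.
Variables (B : cstarAlgType R) (I : ideal B).

(* Continuous induction on the right end point [x] of the interval on which [p]
   approximately lifts [d]; the lift is exact at [x], so that it can be continued
   by linear interpolation. *)
Lemma approximate_path_lift (d : R -> quot I) (a b M e : R) :
  a <= b -> ncont d -> d a = 0 -> (forall t, nrm (d t) <= M) -> 0 < e ->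
  exists p : R -> B, [/\ ncont p, p a = 0, forall t, nrm (p t) <= M + e &
    forall t, a <= t <= b -> nrm (d t - quot_hom I (p t)) <= e].
Proof.
move=> ab cd da dM e0.
have M0 : 0 <= M by apply: le_trans (dM a); exact: nrm_ge0.
pose P x := exists p : R -> B, [/\ ncont p, p a = 0, quot_hom I (p x) = d x,
  forall t, nrm (p t) <= M + e &
  forall t, a <= t <= x -> nrm (d t - quot_hom I (p t)) <= e].
suff [p [cp pa _ pM pe]] : P b by exists p.
apply: (continuous_induction ab) => [|x axb].
  exists (fun=> 0); split.
  - exact: ncont_cst.
  - by [].
  - by rewrite linear0.
  - by move=> t; rewrite nrm0 addr_ge0// ltW.
  - move=> t /le_anti <-; by rewrite linear0 da subrr nrm0 ltW.
have e2 : 0 < e / 2 by rewrite divr_gt0.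
have /nearP_dist[h h0 dh] := cd x _ e2; exists h => // s t as_ st tb xs xt.
have [->//|snt] := eqVneq s t.
have lst : s < t by rewrite lt_neqAle snt.
have ts0 : 0 < t - s by rewrite subr_gt0.
move=> [p [cp pa ps pM pe]].
have [y yt yn] := qnrm_lift (d t) e0.
have yM : nrm y <= M + e.
  by rewrite (le_trans (ltW yn))// lerD2r -qnrmE.
pose c r := (clamp s t r - s) / (t - s).
have cc : continuous c.
  move=> r; apply: cvgM; last exact: cvg_cst.
  by apply: cvgB; [exact: clamp_continuous|exact: cvg_cst].
have c01 r : 0 <= c r <= 1.
  have /andP[sc ct] := clamp_itv r st.
  apply/andP; split; first by rewrite divr_ge0// subr_ge0.
  by rewrite ler_pdivrMr// mul1r lerD2r.
have c0 r : r <= s -> c r = 0.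
  by move=> rs; rewrite /c clamp_le// subrr mul0r.
(* [q] stops [p] at [s] and then moves linearly to [y], an exact lift of [d t], reached at [t]. *)
pose q r := p (Num.min s r) + (c r)%:C *: (y - p s).
have qs r : r <= s -> q r = p r.
  by move=> rs; rewrite /q c0// scale0r addr0 (min_idPr rs).
have qs' r : s <= r -> q r = p s + (c r)%:C *: (y - p s).
  by move=> sr; rewrite /q (min_idPl sr).
exists q; split.
- apply: ncontD; first exact: (ncont_comp (@min_continuous R s)).
  by apply: ncontZ => //; exact: ncont_cst.
- by rewrite qs.
- rewrite qs'// /c clamp_ge// divff ?gt_eqF// scale1r addrC subrK.
  exact: yt.
- move=> r; have [rs|/ltW sr] := leP r s; first by rewrite qs.
  by rewrite qs'// nrm_convex.
- move=> r /andP[ar rt]; have [rs|/ltW sr] := leP r s.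
    by rewrite qs// pe// ar.
  (* Up to sign the error is a convex combination of [d s - d r] and [d t - d r]. Both are small
     because [r], [s] and [t] all lie within [h] of [x]. *)
  have pi_q : d r - quot_hom I (q r) =
      - ((d s - d r) + (c r)%:C *: ((d t - d r) - (d s - d r))).
    have yt' : quot_hom I y = d t := yt.
    have qE : quot_hom I (q r) =
        quot_hom I (p s) + (c r)%:C *: (quot_hom I y - quot_hom I (p s)).
      by rewrite qs'// linearD linearZ linearB.
    rewrite qE ps yt'.
    have -> : d t - d r - (d s - d r) = d t - d s by rewrite opprB addrA subrK.
    by rewrite opprD addrA [in RHS]opprD opprB.
  have xr : `|x - r| < h.
    move: xs xt; rewrite !ltr_norml => /andP[? ?] /andP[? ?].
    by apply/andP; split; lra.
  rewrite pi_q nrmN nrm_convex// (le_trans (nrm_triangle (d x) _ _))//.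
    rewrite (nrmBC (d x)); have := dh _ xs; have := dh _ xr; lra.
  rewrite (nrmBC (d x)); have := dh _ xt; have := dh _ xr; lra.
Qed.

Lemma paths_ncont (C : cstarAlgType R) (f : paths C) : ncont f.
Proof. by case: (famP f). Qed.

Fact quot_paths_subproof (f : paths B) :
  path_algebra (quot I) (fun t => hom_comp (quot_hom I) (fam_ev _ t) f).
Proof.
split; last by apply: ncont_hom; exact: paths_ncont.
by exists (nrm f) => t; exact: starHom_nrm_le.
Qed.

Definition quot_paths : starHom (paths B) (paths (quot I)) :=
  fam_hom quot_paths_subproof.

(** Approximate lifts become exact by iteration. Being 0 at [a] and constant outside [[a, b]] is
    inherited by the remaining errors, so the iteration can go on, and it survives in the limit. *)
Lemma path_lift (a b e : R) (d : paths (quot I)) : a <= b -> 0 < e ->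
  d a = 0 -> (forall t, d t = d (clamp a b t)) ->
  exists D : paths B, [/\ D a = 0, forall t, D t = D (clamp a b t),
    forall t, quot_pi I (D t) = d t & nrm D <= nrm d + e].
Proof.
move=> ab e0 da dc.
pose based (C : cstarAlgType R) : set (paths C) :=
  [set f | f a = 0 /\ forall t, f t = f (clamp a b t)].
suff [D [[D0 Dc] Dn Dd]] : exists D : paths B,
    [/\ based B D, nrm D <= nrm d + e & quot_paths D = d].
  by exists D; split=> // t; rewrite -Dd.
have exact_lift := @exact_of_approximate (paths B) (paths (quot I)) quot_paths
  (based B) (based (quot I)).
apply: (exact_lift _ _ _ _ d (nrm d) e) => //.
- exact: starHom_nrm_le.
- move=> f fb; split.
    apply: (@nrm_small _ _ _ 1) => r /fb[g [ga _] fg]; rewrite mul1r.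
    by rewrite (le_trans _ (ltW fg))// -[f a]subr0 -ga (nrm_fam_le (f - g) a).
  move=> t; apply/eqP; rewrite -subr_eq0; apply/eqP.
  apply: (@nrm_small _ _ _ 2) => r /fb[g [_ gc] fg].
  have := nrm_triangle (g t) (f t) (f (clamp a b t)).
  have := nrm_fam_le (f - g) t; have := nrm_fam_le (f - g) (clamp a b t).
  rewrite !famBE -gc (nrmBC (g t)) -fnrmE; lra.
- move=> f g [fa fc] [ga gc]; split=> [|t].
    by rewrite famDE fa ga addr0.
  by rewrite !famDE fc gc.
move=> w M r [wa wc] wM r0.
have wM' t : nrm (w t) <= M by exact: le_trans (nrm_fam_le w t) wM.
have [p [cp pa pM pe]] := approximate_path_lift ab (@paths_ncont _ w) wa wM' r0.
have caa : clamp a b a = a by rewrite clamp_le.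
have ccc t : clamp a b (clamp a b t) = clamp a b t.
  by rewrite clamp_id// clamp_itv.
(* The error of [p] is controlled on [[a, b]] only, so [p] is frozen outside, as [w] is. *)
have Sp : path_algebra B (fun t => p (clamp a b t)).
  split; first by exists (M + r).
  exact: (ncont_comp (@clamp_continuous R a b)).
have M0 : 0 <= M by rewrite (le_trans _ wM)// nrm_ge0.
exists (Fam Sp); split.
- by split=> [|t] /=; rewrite ?caa ?ccc.
- by apply: fnrm_le => [|t]; [rewrite addr_ge0// ltW|exact: pM].
- split=> [|t]; rewrite !famBE /=; first by rewrite caa wa pa quot_pi0 subrr.
  by rewrite ccc -wc.
- rewrite fnrmE fnrm_le ?(ltW r0)// => t.
  by rewrite famBE /= wc pe// clamp_itv.
Qed.

End PathLifting.
End Lifting.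

(** * Homotopy lifting and local path-connectedness *)

Section Homotopies.
Variable R : realType.

Lemma path_ev_ncont (A B : cstarAlgType R) (chi : starHom A (paths B)) a :
  ncont (fun t => hom_comp (fam_ev _ t) chi a).
Proof. exact: paths_ncont. Qed.

Section HomotopyLifting.
Variables (A B : cstarAlgType R) (I : ideal B) (delta : R) (G : {fset A}).
Hypothesis delta0 : 0 < delta.
Hypothesis lift_near : forall (C : cstarAlgType R) (J : ideal C)
  (gamma phi : starHom A (quot J)) (gammabar : starHom A C),
  (forall u, u \in G -> nrm (gamma u - phi u) < delta) ->
  is_lift gammabar gamma -> exists phibar, is_lift phibar phi.

Definition lifted_upto (psi : R -> starHom A (quot I)) (phibar0 : starHom A B)
    (x : R) :=
  exists beta : R -> starHom A B, [/\ forall a, ncont (fun t => beta t a),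
    beta 0 = phibar0 & forall t, 0 <= t <= x -> is_lift (beta t) (psi t)].

(* The paths in [B] are taken modulo those vanishing up to [s] and [I]-valued
   after [s]. In this quotient [psi], prolonging [beta] after [s], is close to
   [beta] stopped at [s], which has a lift. *)
Lemma lifted_step (psi : R -> starHom A (quot I)) (phibar0 : starHom A B)
    (s t : R) :
  (forall a, ncont (fun t => psi t a)) -> 0 <= s -> s <= t ->
  (forall r u, s <= r <= t -> u \in G -> nrm (psi r u - psi s u) <= delta / 2) ->
  lifted_upto psi phibar0 s -> lifted_upto psi phibar0 t.
Proof.
move=> cpsi s0 st near [beta [cbeta beta0 betal]].
have Sd a : path_algebra (quot I) (fun r => psi (clamp s t r) a - psi s a).
  split.
    exists (nrm a + nrm a) => r.
    by rewrite (le_trans (nrmB _ _))// lerD// starHom_nrm_le.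
  apply: ncontB; last exact: ncont_cst.
  exact: (ncont_comp (@clamp_continuous R s t) (cpsi a)).
have d4 : 0 < delta / 4 by rewrite divr_gt0.
(* [D a] lifts the increment of [psi] after [s]. It is chosen separately for each [a]; on [G] its
   norm is at most [3 * delta / 4], which leaves room for a strict bound. *)
have /choice[D DP] a : exists D : paths B,
    [/\ D s = 0, forall r, D r = D (clamp s t r),
    forall r, quot_pi I (D r) = psi (clamp s t r) a - psi s a &
    a \in G -> nrm D <= delta / 2 + delta / 4].
  have [||D [D0 Dc Dpi Dn]] := path_lift (d := Fam (Sd a)) st d4.
  - by rewrite /= clamp_le// subrr.
  - by move=> r /=; rewrite (@clamp_id _ s t (clamp s t r))// clamp_itv.
  exists D; split=> // aG; apply: (le_trans Dn); rewrite lerD2r.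
  apply: fnrm_le => [|r /=]; first by rewrite divr_ge0// ltW.
  by apply: near => //; exact: clamp_itv.
have Sb a : path_algebra B (fun r => beta (Num.min s r) a).
  split; first by exists (nrm a) => r; exact: starHom_nrm_le.
  exact: (ncont_comp (@min_continuous R s) (cbeta a)).
pose gam : starHom A (paths B) := fam_hom Sb.
(* Before [s] this is [beta], and after [s] a lift of [psi] stopped at [t]; hence it is a
   *-homomorphism modulo the ideal given by [K]. *)
pose f a : paths B := gam a + D a.
have fE a r : f a r = beta (Num.min s r) a + D a r by [].
pose K r := if r <= s then zero_ideal B else I.
have D0 a r : r <= s -> D a r = 0.
  by move=> rs; have [Ds Dc _ _] := DP a; rewrite Dc clamp_le.
have fpi r a : s <= r -> quot_pi I (f a r) = psi (clamp s t r) a.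
  move=> sr; rewrite fE quot_piD (min_idPl sr).
  have [_ _ -> _] := DP a.
  have /is_liftP -> : is_lift (beta s) (psi s) by apply: betal; rewrite s0 lexx.
  by rewrite addrC subrK.
have fK : hom_mod (ideal_set (pointwise_ideal (path_algebra B) K)) f.
  apply: hom_mod_pointwise => r; rewrite /K; case: leP => [rs|/ltW sr].
    apply: (hom_mod_congr (phi := beta r)) => a.
    suff : f a r - beta r a = 0 by [].
    by rewrite fE D0// addr0 (min_idPr rs) subrr.
  by apply: (hom_mod_quot (r := psi (clamp s t r))) => a; exact: fpi.
have [||chi chil] := @lift_near _ _ (hom_comp (quot_hom _) gam)
  (hom_of_mod fK) gam.
- move=> u uG; apply: (@le_lt_trans _ _ (delta / 2 + delta / 4)); last by lra.
  apply: hom_of_mod_close; rewrite /f opprD addrA subrr add0r nrmN.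
  by have [_ _ _ ->] := DP u.
- by [].
have chif r a : ideal_set (K r) (chi a r - f a r) := is_lift_mod chil a r.
(* Since the ideal is zero up to [s], the new lift agrees there with [beta], which preserves the
   starting point. *)
have chi_before r : r <= s -> hom_comp (fam_ev _ r) chi = beta r.
  move=> rs; apply: hom_ext => a; have := chif r a.
  rewrite /K rs => /subr0_eq chiE; rewrite -[LHS]/(chi a r) chiE.
  by rewrite fE D0// addr0 (min_idPr rs).
exists (fun r => hom_comp (fam_ev _ r) chi); split.
- exact: path_ev_ncont.
- by rewrite chi_before.
- move=> r /andP[r0 rt]; have [rs|sr] := leP r s.
    by rewrite chi_before//; apply: betal; rewrite r0.
  apply/is_liftP => a; have := chif r a; rewrite /K leNgt sr /=.
  move=> /quot_piP ->; rewrite fpi ?(ltW sr)// clamp_id//.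
  by rewrite (ltW sr).
Qed.

(** Continuous induction on the end point: close to [x] the path stays within [delta / 4] of [psi x]
    on [G], so two nearby times differ by at most the [delta / 2] of [lifted_step]. *)
Lemma lifted_homotopy (psi : R -> starHom A (quot I)) (phibar0 : starHom A B) :
  (forall a, ncont (fun t => psi t a)) -> is_lift phibar0 (psi 0) ->
  lifted_upto psi phibar0 1.
Proof.
move=> cpsi lift0; apply: (@continuous_induction _ _ 0 1) => // [|x _].
  exists (fun=> phibar0); split=> // [a|t /le_anti <-//].
  exact: ncont_cst.
have d4 : 0 < delta / 4 by rewrite divr_gt0.
have := @filter_bigI _ A G (fun u => [set s | nrm (psi s u - psi x u) < delta / 4])
  (nbhs x) (nbhs_filter x) (fun u _ => cpsi u x _ d4).
move=> /nearP_dist[h h0 hG]; exists h => // s t s0 st t1 xs xt.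
apply: lifted_step => // r u /andP[sr rt] uG.
have xr : `|x - r| < h.
  move: xs xt; rewrite !ltr_norml => /andP[? ?] /andP[? ?].
  by apply/andP; split; lra.
have := hG _ xr _ uG; have := hG _ xs _ uG => /= us ur.
rewrite (le_trans (nrm_triangle (psi x u) _ _))// (nrmBC (psi x u)); lra.
Qed.

End HomotopyLifting.

Lemma uniformly_open_homotopy_lifting (A : cstarAlgType R) :
  uniformly_open A -> homotopy_lifting A.
Proof.
move=> uo B I phi phibar0 cphi lift0.
(* Only the existence of a lift matters here, so any tolerance and the empty set serve. *)
have [delta [G [delta0 dG]]] := uo 1 fset0 ltr01.
have near (C : cstarAlgType R) (J : ideal C) (gamma phi' : starHom A (quot J))
    (gammabar : starHom A C) :
    (forall u, u \in G -> nrm (gamma u - phi' u) < delta) ->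
    is_lift gammabar gamma -> exists phibar, is_lift phibar phi'.
  move=> close lift; have [|phibar []] := dG C J gamma phi' gammabar _ lift.
    by move=> u uG; rewrite nrmE ltcR close.
  by exists phibar.
have := @lifted_homotopy A B I delta G delta0 near
  (fun t => phi (clamp 0 1 t)) phibar0 (within_ncont cphi).
rewrite clamp_le// => /(_ lift0)[beta [cbeta beta0 betal]].
exists beta; split=> //; first exact: ncont_within.
move=> t t01; have {}t01 : 0 <= t <= 1 by move: t01; rewrite in_itv.
by have := betal t t01; rewrite clamp_id.
Qed.

(* The paths in [B] are taken modulo those vanishing at both ends, so that a
   *-homomorphism into the quotient is a pair of *-homomorphisms into [B]. *)
Lemma uniformly_open_short_path (A : cstarAlgType R) (eps : R) (F : {fset A}) :
  uniformly_open A -> 0 < eps ->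
  exists (delta : R) (G : {fset A}), 0 < delta /\
    forall (B : cstarAlgType R) (phi psi : starHom A B),
      (forall u, u \in G -> nrm (psi u - phi u) < delta) ->
      exists chi : R -> starHom A B,
        [/\ forall a, ncont (fun t => chi t a), chi 0 = phi, chi 1 = psi &
            forall t v, v \in F -> nrm (chi t v - phi v) < eps].
Proof.
move=> uo eps0; have [delta [G [delta0 dG]]] := uo eps F eps0.
(* Halving keeps the bound strict after taking the supremum over the path. *)
have d2 : 0 < delta / 2 by rewrite divr_gt0.
exists (delta / 2), G; split=> // B phi psi close.
have c01 t : 0 <= clamp (0 : R) 1 t <= 1 by exact: clamp_itv.
have Sphi a : path_algebra B (fun=> phi a).
  by split; [exists (nrm (phi a))|exact: ncont_cst].
(* The segment from [phi] to [psi] need not consist of *-homomorphisms, but modulo functions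
   vanishing at the ends only its end points count. *)
have Sf a : path_algebra B
    (fun t => phi a + (clamp 0 1 t)%:C *: (psi a - phi a)).
  split.
    exists (nrm a) => t; apply: nrm_convex => //; exact: starHom_nrm_le.
  apply: ncontD; first exact: ncont_cst.
  apply: ncontZ; [exact: clamp_continuous|exact: ncont_cst].
pose gam : starHom A (paths B) := fam_hom Sphi.
pose f a : paths B := Fam (Sf a).
pose K (t : R) := if t <= 0 then zero_ideal B
  else if 1 <= t then zero_ideal B else full_ideal B.
have f0 a t : t <= 0 -> f a t = phi a.
  by move=> t0; rewrite /= clamp_le// scale0r addr0.
have f1 a t : 1 <= t -> f a t = psi a.
  by move=> t1; rewrite /= clamp_ge// scale1r addrC subrK.
have fK : hom_mod (ideal_set (pointwise_ideal (path_algebra B) K)) f.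
  apply: hom_mod_pointwise => t; rewrite /K.
  case: (leP t 0) => [t0|_]; last case: (leP 1 t) => [t1|_]; last by split.
    by apply: (hom_mod_congr (phi := phi)) => a;
      suff : f a t - phi a = 0 by []; rewrite f0// subrr.
  by apply: (hom_mod_congr (phi := psi)) => a;
    suff : f a t - psi a = 0 by []; rewrite f1// subrr.
have [|//|chi [chil chiF]] := dG _ _ (hom_comp (quot_hom _) gam)
  (hom_of_mod fK) gam.
  move=> u uG; rewrite nrmE ltcR; apply: (@le_lt_trans _ _ (delta / 2)); last by lra.
  apply: hom_of_mod_close; apply: fnrm_le => [|t]; first exact: ltW.
  rewrite famBE /= opprD addrA subrr add0r nrmN nrmZR.
  have /andP[c0 c1] := c01 t; rewrite ger0_norm//.
  by rewrite (le_trans _ (ltW (close u uG)))// ler_piMl ?nrm_ge0.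
have chif t a : ideal_set (K t) (chi a t - f a t) := is_lift_mod chil a t.
exists (fun t => hom_comp (fam_ev _ t) chi); split.
- exact: path_ev_ncont.
- apply: hom_ext => a; have := chif 0 a; rewrite /K lexx => /subr0_eq.
  by rewrite f0.
- apply: hom_ext => a; have := chif 1 a.
  by rewrite /K lexx [1 <= 0]leNgt ltr01 => /subr0_eq; rewrite f1.
- move=> t v vF; have := chiF v vF; rewrite nrmE ltcR nrmBC => le.
  by apply: le_lt_trans le; exact: (nrm_fam_le (chi v - gam v) t).
Qed.

(** * Path components inside a set of *-homomorphisms *)

Section Joined.
Variables (A B : cstarAlgType R) (W : set (starHom A B)).

Definition joined (phi psi : starHom A B) := exists gamma : R -> starHom A B,
  [/\ forall a, ncont (fun t => gamma t a), gamma 0 = phi, gamma 1 = psi &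
      forall t, W (gamma t)].

Lemma joined_refl phi : W phi -> joined phi phi.
Proof. by move=> Wphi; exists (fun=> phi); split=> // a; exact: ncont_cst. Qed.

Lemma joined_sym phi psi : joined phi psi -> joined psi phi.
Proof.
move=> [g [cg g0 g1 gW]]; exists (fun t => g (1 - t)); split=> //.
- move=> a; apply: (@ncont_comp _ _ (fun t => g t a) (fun t => 1 - t)) => //.
  by move=> t; apply: cvgB; [exact: cvg_cst|exact: cvg_id].
- by rewrite subr0.
- by rewrite subrr.
Qed.

(* The concatenation is, pointwise, a sum of reparametrized paths: one of them is
   stopped at [psi] while the other one moves. *)
Lemma joined_trans psi phi xi : joined phi psi -> joined psi xi -> joined phi xi.
Proof.
move=> [g [cg g0 g1 gW]] [h [ch h0 h1 hW]].
pose l (t : R) := clamp 0 1 (2 * t); pose r (t : R) := clamp 0 1 (2 * t - 1).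
have c2 : continuous (fun t : R => 2 * t).
  by move=> t; apply: cvgM; [exact: cvg_cst|exact: cvg_id].
have cl : continuous l.
  by move=> t; apply: (@continuous_comp _ _ _ (fun t : R => 2 * t));
    [exact: c2|exact: clamp_continuous].
have cr : continuous r.
  move=> t; apply: (@continuous_comp _ _ _ (fun t : R => 2 * t - 1)).
    by apply: cvgB; [exact: c2|exact: cvg_cst].
  exact: clamp_continuous.
exists (fun t => if t <= 2^-1 then g (l t) else h (r t)); split.
- move=> a.
  rewrite (_ : (fun t => _) = fun t => g (l t) a + (h (r t) a - psi a)).
    apply: ncontD; first exact: (ncont_comp cl (cg a)).
    by apply: ncontB; [exact: (ncont_comp cr (ch a))|exact: ncont_cst].
  apply/funext => t; case: leP => t2.
    have -> : r t = 0 by rewrite /r clamp_le//; lra.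
    by rewrite h0 subrr addr0.
  have -> : l t = 1 by rewrite /l clamp_ge//; lra.
  by rewrite g1 [RHS]addrC subrK.
- by rewrite invr_ge0 ler0n /l mulr0 clamp_le.
- rewrite [1 <= _]leNgt invf_lt1// ltr1n /= /r clamp_ge//; lra.
- by move=> t; case: leP.
Qed.

Lemma joined_path_connected phi :
  path_connected R [set psi | joined phi psi].
Proof.
move=> x y px py.
have [g [cg g0 g1 gW]] := joined_trans (joined_sym px) py.
exists g; split=> //; first exact: ncont_within.
move=> t; rewrite in_itv => /andP[t0 t1] /=; apply: (joined_trans px).
(* The part of [g] up to time [t], reparametrized, joins [x] to [g t]. *)
exists (fun r => g (t * clamp 0 1 r)); split=> //.
- move=> a; apply: (@ncont_comp _ _ (fun t => g t a) (fun r => t * clamp 0 1 r)) => //.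
  by move=> r; apply: cvgM; [exact: cvg_cst|exact: clamp_continuous].
- by rewrite clamp_le// mulr0.
- by rewrite clamp_ge// mulr1.
Qed.

End Joined.

(** The neighbourhood is the path component of [phi] in the interior of [U]. It is open because
    every point near one of its members is joined to that member by a short path inside this
    interior. *)
Lemma uniformly_open_locally_path_connected (A B : cstarAlgType R) :
  uniformly_open A -> locally_path_connected R (starHom A B).
Proof.
move=> uo phi U Uphi.
have short psi : U^° psi -> exists (delta : R) (G : {fset A}), 0 < delta /\
    forall xi, hom_ball psi G delta xi -> joined U^° psi xi.
  move=> Upsi; have /open_nbhs_nbhs [F [e [e0 FU]]] : open_nbhs psi U^°.
    by split=> //; exact: open_interior.
  have [delta [G [delta0 dG]]] := uniformly_open_short_path F uo e0.
  exists delta, G; split=> // xi xiG.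
  have [|chi [cchi chi0 chi1 chiF]] := dG B psi xi.
    by move=> u /xiG; rewrite nrmE ltcR.
  exists chi; split=> // t; apply: FU => a aF.
  by rewrite nrmE ltcR; exact: chiF.
exists [set psi | joined U^° phi psi]; split.
- rewrite openE => psi [g [cg g0 g1 gU]].
  have [|delta [G [delta0 dG]]] := short psi; first by rewrite -g1.
  exists G, delta; split=> // xi /dG; apply: joined_trans.
  by exists g.
- exact: joined_refl.
- by move=> psi [g [_ _ <- gU]]; exact: interior_subset (gU 1).
- exact: joined_path_connected.
Qed.

Lemma homotopy_lifting_l_open (A : cstarAlgType R) : homotopy_lifting A ->
  (forall B : cstarAlgType R, locally_path_connected R (starHom A B)) ->
  l_open A.
Proof.
move=> hl lpc B I; rewrite openE => phi [phibar lphi].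
(* Any path-connected neighbourhood will do, so [U] is the whole space. *)
have [V [oV Vphi _ pcV]] := lpc (quot I) phi setT filterT.
apply: filterS (open_nbhs_nbhs (conj oV Vphi)) => psi Vpsi.
have [g [cg g0 g1 _]] := pcV phi psi Vphi Vpsi.
have [|gbar [_ _ gl]] := hl B I g phibar cg; first by rewrite g0.
by exists (gbar 1); rewrite -g1; apply: gl; rewrite in_itv /= ler01 lexx.
Qed.

End Homotopies.

Theorem theorem3p8 (R : realType) (A : cstarAlgType R) :
  (l_open A <-> uniformly_open A) /\
  (l_open A <->
    (homotopy_lifting A /\
     forall B : cstarAlgType R, locally_path_connected R (starHom A B))).
Proof.
have iii_i : homotopy_lifting A /\
    (forall B : cstarAlgType R, locally_path_connected R (starHom A B)) ->
    l_open A.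
  by move=> [hl lpc]; exact: homotopy_lifting_l_open.
have ii_iii : uniformly_open A -> homotopy_lifting A /\
    forall B : cstarAlgType R, locally_path_connected R (starHom A B).
  move=> uo; split; first exact: uniformly_open_homotopy_lifting.
  by move=> B; exact: uniformly_open_locally_path_connected.
have i_ii := @l_open_uniformly_open R A.
split; split=> //; first by move/ii_iii/iii_i.
by move/i_ii/ii_iii.
Qed.
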